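(* Let $G=(V,E)$ be a connected graph with degree bounded by $d$, let $\epsilon>0$, and let $\alpha,\beta>0$ with $\alpha+\beta=\epsilon/d$. The Kruskal-based Algorithm described below, when run with an integer $k\ge k^K_{\alpha,\beta}(G)$, is a local sparse spanning graph algorithm, with query complexity and running time $O(d\,n_k(G))=O(d^{k+1})$. Kruskal-based Algorithm (parameter $k$, fixed for all queries): on query an edge $(x,y)$, perform a BFS to depth $k$ from $x$, obtaining the subgraph $C_k(x)$ of $G$ induced by $\Gamma_k(x)$. If $(x,y)$ is the edge of largest rank on some cycle in $C_k(x)$, answer NO; otherwise answer YES.
   Context: Graphs have $n=|V|$ vertices, degree bound $d$, and distinct vertex ids from a totally ordered set; access is via incidence-list queries (the $i$-th neighbor of $v$). A local sparse spanning graph algorithm, given $n,\epsilon\ge0,0\le\delta<1$ and query access to a connected graph $G=(V,E)$, answers for each queried edge $(u,v)\in E$ whether $(u,v)\in E'$, where $E'$ is determined by $G$ and the algorithm's internal randomness, such that $G'=(V,E')$ is connected with probability $1$ and $|E'|\le(1+\epsilon)n$ with probability at least $1-\delta$. $\Gamma_k(v)$ is the set of vertices at distance at most $k$ from $v$, and $n_k(G)=\max_v|\Gamma_k(v)|$. The rank $r$ on edges: $r(u,v)<r(u',v')$ iff $\min\{id(u),id(v)\}<\min\{id(u'),id(v')\}$, or these are equal and $\max\{id(u),id(v)\}<\max\{id(u'),id(v')\}$. Define $k^K_{\alpha,\beta}(G)=\min\{k : |\{v\in V: |\Gamma_k(v)|\le\exp(\beta k/2)\}|\ge(1-\alpha)|V|\}$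 ($k$ may exceed the diameter, so this is well defined).
   Formalization: The minimum defining k^K_{α,β}(G) is taken over integers k ≥ 1: at k = 0 every |Γ_0(v)| = 1 = exp(0), so k^K would always be 0, and with k = 0 the algorithm keeps all edges, making the claim false (e.g. K_4 with small ε). *)

(* Defs.v *)
From HB Require Import structures.
From mathcomp Require Import all_boot all_order all_algebra.
From mathcomp Require Import all_classical all_reals all_analysis.

Set Implicit Arguments.
Unset Strict Implicit.
Unset Printing Implicit Defensive.

Import Order.TTheory GRing.Theory Num.Theory.

Local Open Scope ring_scope.

Record sgraph (V : finType) := SGraph {
  adj :> rel V;
  adj_sym : symmetric adj;
  adj_irr : irreflexive adj }.

Definition connected_rel (V : finType) (r : rel V) : Prop :=
  forall u v, connect r u v.

Definition degree_bounded (V : finType) (G : sgraph V) (d : nat) : Prop :=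
  forall v, (#|[set w | G v w]| <= d)%N.

(* The neighbours of v are listed in [inc v] in an arbitrary order, without
   repetition; the i-th neighbour of v is [onth (inc v) i], i >= 0. *)
Definition incidence_lists (V : finType) (G : sgraph V) (inc : V -> seq V) :
    Prop :=
  forall v, uniq (inc v) /\ (forall w, (w \in inc v) = G v w).

Definition walk (V : finType) (G : sgraph V) (m : nat) (u v : V) : bool :=
  [exists p : m.-tuple V, path G u p && (last u p == v)].

(* Gamma_k(v): the distance is the least length of a walk. *)
Definition gball (V : finType) (G : sgraph V) (k : nat) (v : V) : {set V} :=
  [set w | [exists m : 'I_k.+1, walk G m v w]].

Definition max_gball (V : finType) (G : sgraph V) (k : nat) : nat :=
  \max_(v : V) #|gball G k v|.

Definition rank_lt (V : finType) (disp : Order.disp_t) (I : orderType disp)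
    (id : V -> I) (e f : V * V) : bool :=
  let lo := fun g : V * V => Order.min (id g.1) (id g.2) in
  let hi := fun g : V * V => Order.max (id g.1) (id g.2) in
  (lo e < lo f)%O || ((lo e == lo f) && (hi e < hi f)%O).

(* k ranges over the positive integers: at k = 0 every ball has
   1 = exp(0) elements, so that 0 would always qualify. *)
Definition kK_admissible (R : realType) (V : finType) (G : sgraph V)
    (alpha beta : R) : pred nat := fun k =>
  (0 < k)%N &&
  ((1 - alpha) * #|V|%:R <=
   #|[set v | #|gball G k v|%:R <= expR (beta * k%:R / 2)]|%:R).

Lemma kK_ex (R : realType) (V : finType) (G : sgraph V) (alpha beta : R) :
  0 < alpha -> 0 < beta -> exists k, kK_admissible G alpha beta k.
Proof.
move=> a0 b0; pose n : R := #|V|%:R.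
have n0 : 0 <= n by rewrite ler0n.
exists (Num.bound (2 * n / beta)).+1; apply/andP; split=> //.
set k := _.+1.
have kn : n <= expR (beta * k%:R / 2).
  apply: le_trans (expR_ge1Dx _); apply: le_trans (_ : beta * k%:R / 2 <= _).
    rewrite ler_pdivlMr// [n * 2]mulrC [beta * _]mulrC -ler_pdivrMr//.
    apply: le_trans (ltW (archi_boundP _)) _.
      by rewrite divr_ge0 ?mulr_ge0 ?(ltW b0).
    by rewrite ler_nat.
  by rewrite lerDr.
rewrite (_ : [set v | _] = [set: V]).
  by rewrite cardsT ler_piMl// gerBl ltW.
apply/setP => v; rewrite !inE; apply: le_trans kn.
by rewrite ler_nat max_card.
Qed.

Definition kK (R : realType) (V : finType) (G : sgraph V) (alpha beta : R)
    (a0 : 0 < alpha) (b0 : 0 < beta) : nat :=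
  ex_minn (kK_ex G a0 b0).

Definition heaviest_on_cycle (V : finType) (G : sgraph V)
    (disp : Order.disp_t) (I : orderType disp) (id : V -> I)
    (x y : V) (c : seq V) : Prop :=
  [/\ ucycle G c, (2 < size c)%N,
      [/\ x \in c, y \in c & (next c x == y) || (next c y == x)]
    & forall z, z \in c -> ~~ rank_lt id (x, y) (z, next c z)].

Definition kruskal_answer (V : finType) (G : sgraph V)
    (disp : Order.disp_t) (I : orderType disp) (id : V -> I) (k : nat)
    (x y : V) : bool :=
  ~~ `[< exists c : seq V, {subset c <= gball G k x} /\
         heaviest_on_cycle G id x y c >].

(* An edge {u, v} is queried as an ordered pair, and BFS from u may lead to a
   different answer than BFS from v.  [presentation G Q] fixes, for every edge,
   the one of its two ordered pairs under which it is queried. *)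
Definition presentation (V : finType) (G : sgraph V) (Q : {set V * V}) : Prop :=
  (forall u v, (u, v) \in Q -> G u v) /\
  (forall u v, G u v -> ((u, v) \in Q) (+) ((v, u) \in Q)).

Definition kept_edges (V : finType) (Q : {set V * V}) (ans : V -> V -> bool) :
    {set V * V} :=
  [set q in Q | ans q.1 q.2].

Definition undirected (V : finType) (E : {set V * V}) : rel V :=
  fun u v => ((u, v) \in E) || ((v, u) \in E).

(* [ans w u v] is the answer on query (u, v) when the internal randomness of
   the algorithm, of law P, is w. *)
Definition local_sparse_spanning (R : realType) (V : finType) (G : sgraph V)
    (eps delta : R) (disp : measure_display) (T : measurableType disp)
    (P : probability T R) (ans : T -> V -> V -> bool) : Prop :=
  forall Q : {set V * V}, presentation G Q ->
  let connected_event : set T :=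
    [set w | connected_rel (undirected (kept_edges Q (ans w)))]%classic in
  let sparse_event : set T :=
    [set w | #|kept_edges Q (ans w)|%:R <= (1 + eps) * #|V|%:R]%classic in
  [/\ measurable connected_event, P connected_event = 1%E,
      measurable sparse_event & ((1 - delta)%:E <= P sparse_event)%E].

(* A word is empty (None), a number, or a vertex (standing for its id).
   Memory cells are addressed by an array number and a word, as usual for
   running times that ignore the cost of dictionaries on ids.  The only
   arithmetic operation is the successor.  Every node of an expression or test
   and every executed command except CSeq costs one unit of time. *)
Definition word (V : Type) := option (nat + V).

Record state (V : eqType) := State {
  reg : nat -> word V;
  cell : nat -> word V -> word V }.

Inductive expr :=
| ENil
| ECst of nat
| EVar of nat
| EGet of nat & expr
| ESuc of expr.

Inductive test :=
| TEq of expr & expr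
| TLt of expr & expr
| TNot of test
| TAnd of test & test
| TOr of test & test.

Inductive cmd :=
| CSet of nat & expr
| CPut of nat & expr & expr
| CAsk of nat & expr & expr
| CSeq of cmd & cmd
| CIf of test & cmd & cmd
| CWhile of test & cmd.

Fixpoint expr_size (e : expr) : nat :=
  match e with
  | ENil | ECst _ | EVar _ => 1
  | EGet _ e | ESuc e => (expr_size e).+1
  end.

Fixpoint test_size (b : test) : nat :=
  match b with
  | TEq e f | TLt e f => (expr_size e + expr_size f).+1
  | TNot b => (test_size b).+1
  | TAnd b c | TOr b c => (test_size b + test_size c).+1
  end.

Fixpoint eval_expr (V : eqType) (s : state V) (e : expr) : word V :=
  match e with
  | ENil => None
  | ECst n => Some (inl n)
  | EVar x => reg s x
  | EGet a e => cell s a (eval_expr s e)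
  | ESuc e => if eval_expr s e is Some (inl n) then Some (inl n.+1) else None
  end.

Definition word_lt (V : eqType) (disp : Order.disp_t) (I : orderType disp)
    (id : V -> I) (a b : word V) : bool :=
  match a, b with
  | Some (inl m), Some (inl n) => (m < n)%N
  | Some (inr u), Some (inr v) => (id u < id v)%O
  | _, _ => false
  end.

Fixpoint eval_test (V : eqType) (disp : Order.disp_t) (I : orderType disp)
    (id : V -> I) (s : state V) (b : test) : bool :=
  match b with
  | TEq e f => eval_expr s e == eval_expr s f
  | TLt e f => word_lt id (eval_expr s e) (eval_expr s f)
  | TNot b => ~~ eval_test id s b
  | TAnd b c => eval_test id s b && eval_test id s c
  | TOr b c => eval_test id s b || eval_test id s c
  end.

Definition query (V : eqType) (inc : V -> seq V) (a b : word V) : word V :=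
  match a, b with
  | Some (inr v), Some (inl i) => omap inr (onth (inc v) i)
  | _, _ => None
  end.

Definition set_var (V : eqType) (s : state V) (x : nat) (w : word V) :=
  State (fun x' => if x' == x then w else reg s x') (cell s).

Definition set_mem (V : eqType) (s : state V) (a : nat) (i w : word V) :=
  State (reg s)
    (fun a' i' => if (a' == a) && (i' == i) then w else cell s a' i').

(* [exec inc id c s s' q t]: started in state s, the program c stops in
   state s' after q incidence-list queries and t elementary steps. *)
Inductive exec (V : eqType) (inc : V -> seq V) (disp : Order.disp_t)
    (I : orderType disp) (id : V -> I) :
    cmd -> state V -> state V -> nat -> nat -> Prop :=
| exec_set x e s :
    exec inc id (CSet x e) s (set_var s x (eval_expr s e)) 0 (expr_size e).+1
| exec_put a e f s :
    exec inc id (CPut a e f) s (set_mem s a (eval_expr s e) (eval_expr s f))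
      0 (expr_size e + expr_size f).+1
| exec_ask x e f s :
    exec inc id (CAsk x e f) s (set_var s x (query inc (eval_expr s e) (eval_expr s f)))
      1 (expr_size e + expr_size f).+1
| exec_seq c1 c2 s s1 s2 q1 q2 t1 t2 :
    exec inc id c1 s s1 q1 t1 -> exec inc id c2 s1 s2 q2 t2 ->
    exec inc id (CSeq c1 c2) s s2 (q1 + q2)%N (t1 + t2)%N
| exec_if b c1 c2 s s' q t :
    exec inc id (if eval_test id s b then c1 else c2) s s' q t ->
    exec inc id (CIf b c1 c2) s s' q (test_size b + t).+1
| exec_while_stop b c s :
    ~~ eval_test id s b -> exec inc id (CWhile b c) s s 0 (test_size b).+1
| exec_while_step b c s s1 s2 q1 q2 t1 t2 :
    eval_test id s b ->
    exec inc id c s s1 q1 t1 -> exec inc id (CWhile b c) s1 s2 q2 t2 ->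
    exec inc id (CWhile b c) s s2 (q1 + q2)%N (test_size b + t1 + t2).+1.

Declare Scope cmd_scope.
Delimit Scope cmd_scope with cmd.
Local Notation "x '::=' e" := (CSet x e) (at level 60) : cmd_scope.
Local Notation "c1 ';;' c2" := (CSeq c1 c2) (at level 65, right associativity)
  : cmd_scope.

Definition vX := 0%N.
Definition vY := 1%N.
Definition vK := 2%N.
Definition vAns := 3%N.
Definition vHead := 4%N.
Definition vTail := 5%N.
Definition vFree := 6%N.
Definition vU := 7%N.
Definition vW := 8%N.
Definition vI := 9%N.
Definition vLo := 10%N.
Definition vHi := 11%N.
Definition vLoXY := 12%N.
Definition vHiXY := 13%N.

Definition aDist := 0%N.
Definition aQueue := 1%N.
Definition aStart := 2%N.
Definition aList := 3%N.
Definition aSeen := 4%N.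
Definition aQueue2 := 5%N.

(* BFS to depth K from X.  A vertex u belongs to C_K(X) iff Dist[u] is not
   empty; the incidence list of such a u is copied to List[Start[u]],
   List[Start[u] + 1], ... and is followed by an empty cell. *)
Definition bfs_prog : cmd := (
  vHead ::= ECst 0 ;; vTail ::= ECst 1 ;; vFree ::= ECst 0 ;;
  CPut aQueue (ECst 0) (EVar vX) ;;
  CPut aDist (EVar vX) (ECst 0) ;;
  CWhile (TLt (EVar vHead) (EVar vTail)) (
    vU ::= EGet aQueue (EVar vHead) ;;
    vHead ::= ESuc (EVar vHead) ;;
    CPut aStart (EVar vU) (EVar vFree) ;;
    vI ::= ECst 0 ;;
    CAsk vW (EVar vU) (EVar vI) ;;
    CWhile (TNot (TEq (EVar vW) ENil)) (
      CPut aList (EVar vFree) (EVar vW) ;;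
      vFree ::= ESuc (EVar vFree) ;;
      CIf (TAnd (TEq (EGet aDist (EVar vW)) ENil)
              (TLt (EGet aDist (EVar vU)) (EVar vK))) (
        CPut aDist (EVar vW) (ESuc (EGet aDist (EVar vU))) ;;
        CPut aQueue (EVar vTail) (EVar vW) ;;
        vTail ::= ESuc (EVar vTail)
      ) (
        vW ::= EVar vW
      ) ;;
      vI ::= ESuc (EVar vI) ;;
      CAsk vW (EVar vU) (EVar vI)
    ) ;;
    vFree ::= ESuc (EVar vFree)
  ))%cmd.

Definition sort_prog (lo hi u w : nat) : cmd := (
  CIf (TLt (EVar w) (EVar u))
    (lo ::= EVar w ;; hi ::= EVar u)
    (lo ::= EVar u ;; hi ::= EVar w))%cmd.

(* (X, Y) has the largest rank on some cycle of C_K(X) iff Y can be reached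
   from X inside C_K(X) through edges of smaller rank than (X, Y). *)
Definition cycle_prog : cmd := (
  sort_prog vLoXY vHiXY vX vY ;;
  vHead ::= ECst 0 ;; vTail ::= ECst 1 ;;
  CPut aQueue2 (ECst 0) (EVar vX) ;;
  CPut aSeen (EVar vX) (ECst 1) ;;
  CWhile (TLt (EVar vHead) (EVar vTail)) (
    vU ::= EGet aQueue2 (EVar vHead) ;;
    vHead ::= ESuc (EVar vHead) ;;
    vI ::= EGet aStart (EVar vU) ;;
    CWhile (TNot (TEq (EGet aList (EVar vI)) ENil)) (
      vW ::= EGet aList (EVar vI) ;;
      vI ::= ESuc (EVar vI) ;;
      sort_prog vLo vHi vU vW ;;
      CIf (TAnd (TNot (TEq (EGet aDist (EVar vW)) ENil))
         (TAnd (TEq (EGet aSeen (EVar vW)) ENil)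
              (TOr (TLt (EVar vLo) (EVar vLoXY))
                  (TAnd (TEq (EVar vLo) (EVar vLoXY))
                       (TLt (EVar vHi) (EVar vHiXY)))))) (
        CPut aSeen (EVar vW) (ECst 1) ;;
        CPut aQueue2 (EVar vTail) (EVar vW) ;;
        vTail ::= ESuc (EVar vTail)
      ) (
        vW ::= EVar vW
      )
    )
  ) ;;
  CIf (TEq (EGet aSeen (EVar vY)) ENil) (vAns ::= ECst 1) (vAns ::= ECst 0))%cmd.

Definition kruskal_prog : cmd := CSeq bfs_prog cycle_prog.

Definition init_state (V : eqType) (k : nat) (x y : V) : state V :=
  set_var (set_var (set_var (State (fun=> None) (fun _ _ => None))
    vX (Some (inr x))) vY (Some (inr y))) vK (Some (inl k)).

(* On query (x, y) the program c with parameter k answers b, within q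
   incidence-list queries and t elementary steps. *)
Definition answers_within (V : eqType) (inc : V -> seq V)
    (disp : Order.disp_t) (I : orderType disp) (id : V -> I)
    (c : cmd) (k : nat) (x y : V) (b : bool) (q t : nat) : Prop :=
  exists s' q' t',
    [/\ exec inc id c (init_state k x y) s' q' t',
        reg s' vAns = Some (inl (nat_of_bool b)), (q' <= q)%N & (t' <= t)%N].

(* Main.v *)
Require Import Defs.
From HB Require Import structures.
From mathcomp Require Import all_boot all_order all_algebra.
From mathcomp Require Import all_classical all_reals all_analysis.
From mathcomp Require Import zify lra.
(* Restores the finite-set names shadowed by classical_sets. *)
From mathcomp Require Import fintype finset.

(** An edge (x, y) is rejected iff y can be reached from x inside Gamma_k(x)
    through edges of smaller rank.  Hence, by induction on the rank, the ends
    of every rejected edge remain connected.  For sparsity, answers only become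
    more negative when k grows, so one may take k minimal.  In the subgraph
    induced by the vertices with |Gamma_k(v)| <= exp(beta k / 2), some ball B_j
    with 2 j <= k satisfies |B_(j+1)| <= exp(beta) |B_j|.  Since B_j lies in
    Gamma_k(x) for each of its vertices x, the kept edges inside B_j form a
    forest; the edges at B_(j+1) \ B_j number at most d beta |B_(j+1)|.
    Removing B_(j+1) and repeating leaves only the edges at the at most
    alpha |V| remaining vertices, at most d alpha |V| of them.  Each of the two
    breadth-first searches of the program scans the incidence list of a vertex
    of Gamma_k(x) at most once, which bounds its running time. *)

Set Implicit Arguments.
Unset Strict Implicit.
Unset Printing Implicit Defensive.

Import Order.TTheory GRing.Theory Num.Theory.

Local Open Scope nat_scope.

(** * Ranks, balls and cycles *)

Lemma leq_card_bigcup (T J : finType) (A : {set J}) (F : J -> {set T}) :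
  #|\bigcup_(i in A) F i| <= \sum_(i in A) #|F i|.
Proof.
elim/big_rec2: _ => [|i n B _ IH]; first by rewrite cards0.
by apply: leq_trans (leq_card_setU _ _) _; rewrite leq_add2l.
Qed.

(** * The rank as a strict order on unordered edges *)

Section Rank.
Variables (V : finType) (disp : Order.disp_t) (I : orderType disp).
Variables (id : V -> I).
Hypothesis id_inj : injective id.
Implicit Types e f g : V * V.

Definition swap_edge e := (e.2, e.1).

Lemma rank_lt_swapl e f : rank_lt id (swap_edge e) f = rank_lt id e f.
Proof. by rewrite /rank_lt /= (minC (id _.2)) (maxC (id _.2)). Qed.

Lemma rank_lt_swapr e f : rank_lt id e (swap_edge f) = rank_lt id e f.
Proof. by rewrite /rank_lt /= (minC (id _.2)) (maxC (id _.2)). Qed.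

Lemma rank_ltxx e : rank_lt id e e = false.
Proof. by rewrite /rank_lt !ltxx andbF. Qed.

Lemma rank_lt_trans : transitive (rank_lt id).
Proof.
move=> f e g /orP[ef|/andP[/eqP ef ef']] /orP[fg|/andP[/eqP fg fg']];
  apply/orP.
- by left; apply: lt_trans ef fg.
- by left; rewrite -fg.
- by left; rewrite ef.
- by right; rewrite ef fg eqxx (lt_trans ef' fg').
Qed.

Lemma rank_lt_asym e f : rank_lt id e f -> ~~ rank_lt id f e.
Proof.
by move=> ef; apply/negP => /(rank_lt_trans ef); rewrite rank_ltxx.
Qed.

(** The smaller and the larger id determine the unordered pair, [id] being injective; so only an
    edge and its reversal can tie. *)
Lemma rank_lt_total e f :
  [\/ rank_lt id e f, rank_lt id f e, e = f | e = swap_edge f].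
Proof.
rewrite /rank_lt.
case: (ltgtP (Order.min (id e.1) (id e.2)) (Order.min (id f.1) (id f.2))).
- by constructor 1.
- by constructor 2.
move=> lo_eq; rewrite /=.
case: (ltgtP (Order.max (id e.1) (id e.2)) (Order.max (id f.1) (id f.2))).
- by constructor 1.
- by constructor 2.
move: lo_eq; rewrite /swap_edge; case: e f => [a b] [c d] /=.
case: (ltgtP (id a) (id b)) => [_|_|/id_inj <-];
  case: (ltgtP (id c) (id d)) => [_|_|/id_inj <-];
  move=> /id_inj E1 /id_inj E2; subst;
  solve [constructor 3; done | constructor 4; done].
Qed.

(** A numerical height for the rank: inductions on the rank and the choice of an edge of largest
    rank are made on this number. *)
Definition rank_nb e := #|[set f | rank_lt id f e]|.

Lemma rank_nb_lt e f : rank_lt id e f -> rank_nb e < rank_nb f.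
Proof.
move=> ef; apply: proper_card; apply/properP; split.
  by apply/subsetP => g; rewrite !inE => /rank_lt_trans; apply.
by exists e; rewrite !inE // rank_ltxx.
Qed.

End Rank.

(** * Balls and their growth under the degree bound *)

Section Balls.
Variables (V : finType) (G : sgraph V).

Lemma gballP k u w :
  reflect (exists p, [/\ path G u p, last u p = w & size p <= k])
          (w \in gball G k u).
Proof.
rewrite inE; apply: (iffP existsP) => [[m /existsP[p /andP[Gp /eqP pw]]]|].
  by exists p; rewrite size_tuple -ltnS.
move=> [p [Gp pw pk]]; exists (Ordinal (pk : size p < k.+1)).
by apply/existsP; exists (in_tuple p); rewrite Gp /= pw.
Qed.

Lemma gball_refl k u : u \in gball G k u.
Proof. by apply/gballP; exists [::]. Qed.

Lemma gball_sym k u w : (w \in gball G k u) = (u \in gball G k w).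
Proof.
suff sub a b : b \in gball G k a -> a \in gball G k b.
  by apply/idP/idP; apply: sub.
case/gballP => p [Gp pw pk]; apply/gballP; exists (rev (belast a p)).
rewrite -pw rev_path (eq_path (e' := G)); last first.
  by move=> c c'; rewrite adj_sym.
rewrite size_rev size_belast; split=> //.
by case: (p) => //= b' q; rewrite rev_cons last_rcons.
Qed.

Lemma gball_trans a b u v w :
  v \in gball G a u -> w \in gball G b v -> w \in gball G (a + b) u.
Proof.
case/gballP => p [Gp pv pk] /gballP[q [Gq qw qk]].
apply/gballP; exists (p ++ q).
by rewrite cat_path Gp pv Gq last_cat pv qw size_cat leq_add.
Qed.

Lemma gball_sub a b u : a <= b -> gball G a u \subset gball G b u.
Proof.
move=> ab; apply/subsetP => w /gballP[p [Gp pw pa]].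
by apply/gballP; exists p; rewrite (leq_trans pa).
Qed.

Lemma gball0 u : gball G 0 u = [set u].
Proof.
apply/setP => w; rewrite in_set1; apply/gballP/eqP => [[[|? ?] [//]]|->].
by exists [::].
Qed.

Lemma gballSP k u w :
  reflect (w = u \/ exists2 v, v \in gball G k u & G v w)
          (w \in gball G k.+1 u).
Proof.
apply: (iffP idP) => [/gballP[p]|].
  case/lastP: p => [|p v] [Gp pw pk]; first by left.
  right; move: Gp pw pk; rewrite rcons_path last_rcons size_rcons => /andP[Gp].
  by move=> + <- ?; exists (last u p) => //; apply/gballP; exists p.
case=> [->|[v vk vw]]; first exact: gball_refl.
by rewrite -addn1; apply: gball_trans vk _; apply/gballP; exists [:: w];
  rewrite /= vw.
Qed.

Lemma edge_gball k u v w :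
  v \in gball G k u -> G v w -> w \in gball G k.+1 u.
Proof. by move=> vk vw; apply/gballSP; right; exists v. Qed.

Lemma card_gballS d k u : degree_bounded G d ->
  #|gball G k.+1 u| <= 1 + d * #|gball G k u|.
Proof.
move=> Gd; pose N := \bigcup_(v in gball G k u) [set w | G v w].
have sub : gball G k.+1 u \subset u |: N.
  apply/subsetP => w /gballSP[->|[v vk vw]]; rewrite !inE ?eqxx //.
  by apply/orP; right; apply/bigcupP; exists v => //; rewrite inE.
apply: leq_trans (subset_leq_card sub) _.
apply: leq_trans (leq_card_setU _ _) _; rewrite cards1 leq_add2l.
apply: leq_trans (leq_card_bigcup _ _) _ => /=.
rewrite mulnC -sum_nat_const; exact: leq_sum.
Qed.

(** For $d \ge 2$ the strict bound $|\Gamma_k| < 2 d^k$ is preserved by $N \mapsto 1 + dN$. For $d =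
    1$ every ball consists of [u] and at most one neighbour. *)
Lemma card_gball_le d k u : 0 < d -> degree_bounded G d ->
  #|gball G k u| <= 2 * d ^ k.
Proof.
case: d => // -[_ Gd|d _ Gd]; last first.
  suff: #|gball G k u| < 2 * d.+2 ^ k by apply: ltnW.
  elim: k => [|k IHk]; first by rewrite gball0 cards1.
  apply: leq_ltn_trans (card_gballS _ _ Gd) _; rewrite expnS; nia.
rewrite exp1n muln1.
have sub : gball G k u \subset u |: [set w | G u w].
  elim: k => [|k IHk]; first by rewrite gball0 sub1set setU11.
  apply/subsetP => w /gballSP[->|[v /(subsetP IHk)]]; first by rewrite setU11.
  rewrite !inE => /orP[/eqP-> ->|uv vw]; first by rewrite orbT.
  have /card_le1_eqP := Gd v => /(_ u w); rewrite !inE => ->; rewrite ?eqxx //.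
  by rewrite adj_sym.
apply: leq_trans (subset_leq_card sub) _.
by apply: leq_trans (leq_card_setU _ _) _; rewrite cards1 leq_add2l.
Qed.

Lemma max_gball_le d k : 0 < d -> degree_bounded G d ->
  max_gball G k <= 2 * d ^ k.
Proof. by move=> d0 Gd; apply/bigmax_leqP => v _; apply: card_gball_le. Qed.

End Balls.

(** * Cycles with a heaviest edge as reachability by lighter edges *)

Section Light.
Variables (V : finType) (G : sgraph V).
Variables (disp : Order.disp_t) (I : orderType disp) (id : V -> I).
Hypothesis id_inj : injective id.

(** Cycles in [C_k(x)] with heaviest edge [(x, y)] are traded for reachability of [y] from [x] under
    this relation, which is what both the connectivity argument and the program use. *)
Definition light k x y : rel V := fun u w =>
  [&& G u w, u \in gball G k x, w \in gball G k x & rank_lt id (u, w) (x, y)].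

Lemma light_sym k x y : symmetric (light k x y).
Proof.
move=> u w; rewrite /light adj_sym -(rank_lt_swapl _ (u, w)).
by congr (_ && _); rewrite andbCA.
Qed.

(** A simple path of lighter edges from [x] to [y], closed by the edge from [y] back to [x], is the
    required cycle. *)
Lemma connect_light_heaviest k x y : G x y -> connect (light k x y) x y ->
  exists c, {subset c <= gball G k x} /\ heaviest_on_cycle G id x y c.
Proof.
move=> Gxy /connectP[p0 Lp0 yp0].
case: (shortenP Lp0) yp0 => p Lp Up _ yp {p0 Lp0}.
have pG : path G x p by apply: sub_path Lp => a b /and4P[].
have nxy : x != y by apply/eqP => xy; rewrite xy adj_irr in Gxy.
have next_light z : z \in x :: p -> z != y -> light k x y z (next (x :: p) z).
  move=> zp zy; rewrite next_nth zp.
  have zi : index z (x :: p) < size p.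
    have := zp; rewrite -index_mem /= ltnS leq_eqVlt => /orP[/eqP zl|//].
    case/eqP: zy; rewrite yp -[z in LHS](nth_index x zp).
    by rewrite [index z _]zl nth_last.
  by have := pathP x Lp _ zi; rewrite -/(nth x (x :: p) _) nth_index.
have nexty : next (x :: p) y = x.
  have -> : y = nth x (x :: p) (size p) by rewrite nth_last.
  by rewrite next_nth mem_nth // index_uniq // nth_default.
have yc : y \in x :: p by rewrite yp mem_last.
exists (x :: p); split.
  move=> z zp; have [->|zy] := eqVneq z y.
    move: yp Lp; case/lastP: (p) => [->|q b]; first by rewrite gball_refl.
    by rewrite last_rcons rcons_path => <- /andP[_ /and4P[]].
  by case/and4P: (next_light z zp zy).
split.
- by rewrite /ucycle /cycle rcons_path pG -yp adj_sym Gxy.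
(* The cycle has at least three vertices: an empty [p] gives [x = y], and a one-element [p] makes
   [(x, y)] lighter than itself. *)
- case: p {pG Up next_light nexty yc} yp Lp => [yx|a [|//]].
    by rewrite yx eqxx in nxy.
  by move=> /= <- /andP[/and4P[_ _ _]]; rewrite rank_ltxx.
- by rewrite mem_head yc nexty eqxx orbT.
move=> z zp; have [->|zy] := eqVneq z y.
  by rewrite nexty -[(y, x)]/(swap_edge (x, y)) rank_lt_swapr rank_ltxx.
by case/and4P: (next_light z zp zy) => _ _ _ /rank_lt_asym.
Qed.

(** Rotated to start at [b], the cycle walks to [a] along all its edges but the heaviest; each of
    these differs from [(x, y)] and is not heavier, hence is strictly lighter. The pair [(a, b)]
    covers both directions in which the cycle may traverse the edge. *)
Lemma ucycle_connect_light k x y a b c :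
  (a, b) = (x, y) \/ (a, b) = (y, x) ->
  {subset c <= gball G k x} -> ucycle G c -> 2 < size c ->
  a \in c -> b \in c -> next c a = b ->
  (forall z, z \in c -> ~~ rank_lt id (x, y) (z, next c z)) ->
  connect (light k x y) b a.
Proof.
move=> abxy cB /andP[Gc Uc] c2 ac bc nab heavy.
have [i p cp] := rot_to bc.
have Up : uniq (b :: p) by rewrite -cp rot_uniq.
have nextE z : next c z = next (b :: p) z by rewrite -cp next_rot.
have memE z : (z \in c) = (z \in b :: p) by rewrite -cp mem_rot.
have sp : 1 < size p.
  by rewrite -ltnS -[(size p).+1]/(size (b :: p)) -cp size_rot.
have ap : a = last b p.
  rewrite -(prev_next Up a) -nextE nab.
  have -> : prev (b :: p) b = last b p by rewrite prev_nth mem_head /=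
    memNindex ?nth_last //; case/andP: Up.
  by [].
apply/connectP; exists p => //; apply/(pathP b) => j jp.
have jp' : j < size (b :: p) by rewrite ltnS ltnW.
set z := nth b (b :: p) j.
have zc : z \in c by rewrite memE mem_nth.
have nz : next c z = nth b p j by rewrite nextE next_nth mem_nth // index_uniq.
have nzc : next c z \in c by rewrite mem_next.
apply/and4P; split; rewrite -?nz ?cB //; first exact: next_cycle.
(* As vertices do not repeat, [z = a] would put [z] at the last position, and [z = b] with successor
   [a] would leave a cycle of length two. *)
have same_edge : (z, next c z) <> (a, b) /\ (z, next c z) <> (b, a).
  have aE : a = nth b (b :: p) (size p) by rewrite nth_last.
  split=> -[zE nE].
    move/eqP: zE; rewrite aE nth_uniq // => /eqP jE; by rewrite jE ltnn in jp.
  move/eqP: zE; rewrite -[X in _ == X]/(nth b (b :: p) 0) nth_uniq //.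
  move=> /eqP jE.
  move: nE; rewrite nz aE jE -[nth b p 0]/(nth b (b :: p) 1) => /eqP.
  by rewrite nth_uniq //= ?ltnS ?(ltnW sp) // => /eqP pE; rewrite -pE in sp.
have := heavy z zc; case: (rank_lt_total id_inj (z, next c z) (x, y)) => //.
- by move=> ->.
- by move=> E; case: same_edge; rewrite E; case: abxy => [[-> ->]|[-> ->]].
- by move=> E; case: same_edge; rewrite E; case: abxy => [[-> ->]|[-> ->]].
Qed.

Lemma kruskal_answerE k x y : G x y ->
  kruskal_answer G id k x y = ~~ connect (light k x y) x y.
Proof.
move=> Gxy; congr negb; apply/asboolP/idP; last exact: connect_light_heaviest.
case=> c [cB [Gc c2 [xc yc /orP nxt] heavy]].
case: nxt => /eqP nxt; last first.
  by apply: (ucycle_connect_light (a := y)) nxt heavy => //; right.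
rewrite (sym_connect_sym (light_sym k x y)).
by apply: (ucycle_connect_light (a := x)) nxt heavy => //; left.
Qed.

End Light.

(** * Connectivity and sparsity *)

Lemma undirected_sym (V : finType) (F : {set V * V}) : symmetric (undirected F).
Proof. by move=> u w; rewrite /undirected orbC. Qed.

(** * Connectivity of the kept edges, and the forest bound inside small balls *)

Section Spanning.
Variables (V : finType) (G : sgraph V).
Variables (disp : Order.disp_t) (I : orderType disp) (id : V -> I).
Hypothesis id_inj : injective id.

Lemma kruskal_connected k (Q : {set V * V}) :
  connected_rel G -> presentation G Q ->
  connected_rel (undirected (kept_edges Q (kruskal_answer G id k))).
Proof.
move=> Gc [QG Qpres]; set E := kept_edges _ _ => u v.
suff edge n x y : rank_nb id (x, y) < n -> G x y ->
    connect (undirected E) x y.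
  apply: connect_sub (Gc u v) => x y; exact: edge.
elim: n x y => // n IHn x y xyn Gxy.
(* [Q] holds exactly one orientation of each edge, and both orientations have the same [rank_nb]. *)
wlog xyQ : x y xyn Gxy / (x, y) \in Q => [hwlog|].
  case: (boolP ((x, y) \in Q)) => [|nQ]; first exact: hwlog.
  rewrite (sym_connect_sym (@undirected_sym _ E)); apply: hwlog.
  - rewrite /rank_nb (eq_card (B := [set f | rank_lt id f (x, y)])) // => f.
    by rewrite !inE -[(y, x)]/(swap_edge (x, y)) rank_lt_swapr.
  - by rewrite adj_sym.
  - by have := Qpres _ _ Gxy; rewrite (negPf nQ).
case: (boolP (kruskal_answer G id k x y)) => [ans|].
  by apply: connect1; rewrite /undirected !inE xyQ /= ans.
(* A rejected edge is bypassed by lighter edges, to which the induction hypothesis applies. *)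
rewrite kruskal_answerE // negbK; apply: connect_sub => a b /and4P[Gab _ _ ab].
by apply: IHn => //; apply: leq_trans (rank_nb_lt ab) _.
Qed.

(** A cycle inside the smaller ball also lies inside the larger one. Sparsity therefore passes from
    a depth to all larger depths. *)
Lemma kruskal_answer_sub a b x y : a <= b ->
  kruskal_answer G id b x y -> kruskal_answer G id a x y.
Proof.
move=> ab; apply: contra => /asboolP[c [cB heavy]]; apply/asboolP.
by exists c; split=> // z /cB; apply: (subsetP (gball_sub _ _ ab)).
Qed.

(* Kruskal's algorithm: inserting the edges by increasing rank, each of them
   merges two classes of the labelling [c]. *)
Lemma forest_labelling (B : {set V}) (F : {set V * V}) :
  (forall q, q \in F -> (q.1 \in B) && (q.2 \in B)) ->
  (forall q, q \in F -> swap_edge q \notin F) ->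
  (forall q, q \in F ->
    ~~ connect (undirected [set f in F | rank_lt id f q]) q.1 q.2) ->
  exists c : V -> V, (forall u w, c u = c w -> connect (undirected F) u w) /\
    #|c @: B| + #|F| <= #|B|.
Proof.
move: {2}(#|F|) (erefl #|F|) => n; elim: n F => [|n IHn] F Fn FB Fs Fnc.
  by exists (fun u => u); split=> [u w ->|]; rewrite ?imset_id ?Fn ?addn0.
have [q0 q0F] : exists q, q \in F by apply/card_gt0P; rewrite Fn.
(* The heaviest edge [q] is inserted last: the induction hypothesis labels [F :\ q]. *)
pose q := [arg max_(f > q0 in F) rank_nb id f].
have [qF qmax] : q \in F /\ forall f, f \in F -> rank_nb id f <= rank_nb id q.
  by rewrite /q; case: arg_maxnP.
have Flt : [set f in F | rank_lt id f q] = F :\ q.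
  apply/setP => f; rewrite !inE andbC; case: (boolP (f \in F)) => fF;
    rewrite ?andbF //= !andbT.
  have [->|fq] := eqVneq f q; first by rewrite rank_ltxx.
  case: (rank_lt_total id_inj f q) => //.
  - by move=> /rank_nb_lt; rewrite ltnNge qmax.
  - by move=> fqE; rewrite fqE eqxx in fq.
  - by move=> fE; have := Fs q qF; rewrite -fE fF.
have Fsub f : f \in F :\ q -> f \in F by case/setD1P.
have [||||c [cF cB]] := IHn (F :\ q).
- by apply/eqP; rewrite -eqSS -Fn (cardsD1 q F) qF.
- by move=> f /Fsub /FB.
- by move=> f /Fsub /Fs; apply: contra => /Fsub.
- move=> f /Fsub /Fnc; apply: contra; apply: connect_sub => a b.
  move=> ab; apply: connect1; move: ab; rewrite /undirected !inE.
  by case/orP=> /andP[/andP[_ ->] ->]; rewrite ?orbT.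
have /andP[q1B q2B] := FB q qF.
have F'F : subrel (connect (undirected (F :\ q))) (connect (undirected F)).
  apply: connect_sub => a b ab; apply: connect1; move: ab; rewrite /undirected.
  by case/orP=> /Fsub ->; rewrite ?orbT.
have q12 : connect (undirected F) q.1 q.2.
  by apply: connect1; rewrite /undirected -surjective_pairing qF.
have q21 : connect (undirected F) q.2 q.1.
  by rewrite (sym_connect_sym (@undirected_sym _ F)).
(* Equal labels would connect the ends of [q] by edges of smaller rank. *)
have cq : c q.1 != c q.2.
  by apply: contra (Fnc q qF) => /eqP /cF; rewrite Flt.
(* Merging the class of [q.2] into that of [q.1] removes one label from the image of [B], which pays
   for the edge [q]. *)
exists (fun u => if c u == c q.2 then c q.1 else c u); split.
  move=> u w; case: eqP => [/cF/F'F uq|_]; case: eqP => [/cF/F'F wq|_].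
  - move=> _; apply: connect_trans uq _.
    by rewrite (sym_connect_sym (@undirected_sym _ F)).
  - by move=> /cF/F'F; apply: connect_trans; apply: connect_trans uq _.
  - move=> /cF/F'F uq; apply: connect_trans uq _; apply: connect_trans q12 _.
    by rewrite (sym_connect_sym (@undirected_sym _ F)).
  - by move=> /cF/F'F.
have sub : [set (if c u == c q.2 then c q.1 else c u) | u in B]
             \subset (c @: B) :\ c q.2.
  apply/subsetP => _ /imsetP[u uB ->]; rewrite !inE.
  have [_|cu] := eqVneq (c u).
    by rewrite cq imset_f.
  by rewrite cu imset_f.
apply: leq_trans cB; rewrite (cardsD1 q F) qF addnA leq_add2r.
rewrite (cardsD1 (c q.2) (c @: B)) imset_f // addnC leq_add2l.
exact: subset_leq_card.
Qed.

(** Since [B] lies in the ball of each of its vertices, a path of lighter edges inside [B] between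
    the ends of an edge is seen by the query and causes its rejection. So the kept edges inside [B]
    form a forest. *)
Lemma card_kept_edges_in k (Q : {set V * V}) (B : {set V}) :
  presentation G Q -> {in B &, forall u w, w \in gball G k u} ->
  #|[set q in kept_edges Q (kruskal_answer G id k) |
      (q.1 \in B) && (q.2 \in B)]| <= #|B|.
Proof.
move=> [QG Qpres] Bk; set F := finset _.
have FP u w : (u, w) \in F ->
    [/\ (u, w) \in Q, kruskal_answer G id k u w, u \in B & w \in B].
  by rewrite !inE => /andP[/andP[-> ->] /andP[-> ->]].
have [|||c [_]] := @forest_labelling B F.
- by case=> u w /FP[_ _ -> ->].
- case=> u w /FP[uwQ _ _ _]; apply/negP => /FP[wuQ _ _ _].
  by have := Qpres _ _ (QG _ _ uwQ); rewrite uwQ wuQ.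
- case=> u w /FP[uwQ + uB wB]; rewrite kruskal_answerE ?QG //=.
  apply: contra; apply: connect_sub => a b ab; apply: connect1; move: ab.
  rewrite /undirected inE [(b, a) \in _]inE.
  case/orP => /andP[/FP[/QG Gab _ aB bB] ab].
    by rewrite /light Gab ab !Bk.
  rewrite /light adj_sym Gab !Bk //=.
  by rewrite -[(a, b)]/(swap_edge (b, a)) rank_lt_swapl.
by move=> le; apply: leq_trans le; rewrite leq_addl.
Qed.

End Spanning.

(** * Sparsity by carving out slowly growing balls *)

Section Sparsity.
Variables (V : finType) (G : sgraph V) (d : nat).
Hypothesis Gd : degree_bounded G d.

(** Because [Q] holds one orientation of each edge, its edges at [u] are determined by their other
    end, so there are at most [d] of them. *)
Lemma card_incident_edges (Q : {set V * V}) (D : {set V}) : presentation G Q ->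
  #|[set q in Q | (q.1 \in D) || (q.2 \in D)]| <= d * #|D|.
Proof.
move=> [QG Qpres]; pose at_ u := [set q in Q | (q.1 == u) || (q.2 == u)].
have at_d u : #|at_ u| <= d.
  pose other (q : V * V) := if q.1 == u then q.2 else q.1.
  rewrite -(card_in_imset (f := other)).
    apply: leq_trans (Gd u); apply: subset_leq_card.
    apply/subsetP => _ /imsetP[[a b] + ->]; rewrite !inE /other /=.
    case: eqP => [-> /andP[/QG ab _]|_ /andP[/QG ab /eqP <-]] //.
    by rewrite adj_sym.
  move=> [a b] [a' b']; rewrite !inE /other /=.
  case: (eqVneq a u) => [->|_]; case: (eqVneq a' u) => [->|_] /=.
  - by move=> _ _ ->.
  - move=> /andP[q _] /andP[q' /eqP b'u] E; rewrite b'u -E in q'.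
    by have := Qpres _ _ (QG _ _ q); rewrite q q'.
  - move=> /andP[q' /eqP bu] /andP[q _] E; rewrite bu E in q'.
    by have := Qpres _ _ (QG _ _ q); rewrite q q'.
  - by move=> /andP[_ /eqP->] /andP[_ /eqP->] ->.
have sub : [set q in Q | (q.1 \in D) || (q.2 \in D)]
             \subset \bigcup_(u in D) at_ u.
  apply/subsetP => q; rewrite !inE => /andP[qQ /orP[]] qD; apply/bigcupP.
    by exists q.1; rewrite // !inE qQ eqxx.
  by exists q.2; rewrite // !inE qQ eqxx orbT.
apply: leq_trans (subset_leq_card sub) _.
apply: leq_trans (leq_card_bigcup _ _) _.
rewrite mulnC -sum_nat_const; exact: leq_sum.
Qed.

(** For [v] in [S], the ball in the subgraph induced by [S]. Recursion on the radius exposes the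
    shell added at each step. *)
Fixpoint ball_in (S : {set V}) (i : nat) (v : V) : {set V} :=
  if i is i'.+1 then
    ball_in S i' v :|: [set w in S | [exists u in ball_in S i' v, G u w]]
  else [set v].

Lemma ball_in_refl (S : {set V}) i v : v \in ball_in S i v.
Proof. by elim: i => [|i IHi] /=; rewrite inE ?eqxx ?IHi. Qed.

Lemma ball_in_sub (S : {set V}) i v : v \in S -> ball_in S i v \subset S.
Proof.
move=> vS; elim: i => [|i IHi] /=; first by rewrite sub1set.
by rewrite subUset IHi; apply/subsetP => w; rewrite inE => /andP[].
Qed.

Lemma ball_in_gball (S : {set V}) i v : ball_in S i v \subset gball G i v.
Proof.
elim: i => [|i IHi] /=; first by rewrite gball0.
rewrite subUset (subset_trans IHi) ?gball_sub //=.
apply/subsetP => w; rewrite inE => /andP[_ /existsP[u /andP[uB uw]]].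
by apply: edge_gball uw; apply: (subsetP IHi).
Qed.

Local Open Scope ring_scope.

(** Otherwise [f] grows by more than the factor $e^\beta$ in each of the [J] steps and ends above
    $e^{\beta J}$. *)
Lemma slow_growth (R : realType) (beta : R) (f : nat -> R) (J : nat) :
  (0 < J)%N -> 1 <= f 0%N -> f J <= expR (beta * J%:R) ->
  exists2 j, (j < J)%N & f j.+1 <= expR beta * f j.
Proof.
move=> J0 f0 fJ; apply: contrapT => nslow.
have fast j : (j < J)%N -> expR beta * f j < f j.+1.
  by move=> jJ; rewrite ltNge; apply/negP => le; apply: nslow; exists j.
have grow j : (j < J)%N -> expR (beta * j.+1%:R) < f j.+1.
  elim: j => [|j IHj] jJ; apply: le_lt_trans (fast _ jJ).
    by rewrite mulr1 ler_peMr // expR_ge0.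
  rewrite -natr1 mulrDr mulr1 addrC expRD ler_pM2l ?expR_gt0 //.
  exact/ltW/IHj/ltnW.
case: J J0 fJ grow {fast nslow} => // J _ fJ.
by move=> /(_ J (leqnn _)); rewrite ltNge fJ.
Qed.

Variables (R : realType) (alpha beta : R).
Hypothesis beta_gt0 : 0 < beta.
Variables (disp : Order.disp_t) (I : orderType disp) (id : V -> I).
Hypothesis id_inj : injective id.

Lemma ball_in_slow_growth k (S : {set V}) v : (0 < k)%N ->
  #|gball G k v|%:R <= expR (beta * k%:R / 2) ->
  exists2 j, (j.*2 <= k)%N &
    #|ball_in S j.+1 v|%:R - #|ball_in S j v|%:R
      <= beta * #|ball_in S j.+1 v|%:R.
Proof.
move=> k0 vk; pose f j : R := #|ball_in S j v|%:R.
(* The choice $J = \lceil k/2 \rceil$ satisfies $k/2 \le J \le k$, as the bound on [f J] requires,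
   while $j < J$ still gives $2j \le k$. *)
have [||| j jk fj] := @slow_growth R beta f (uphalf k).
- by lia.
- by rewrite /f ler1n; apply/card_gt0P; exists v; apply: ball_in_refl.
- apply: (@le_trans _ _ #|gball G k v|%:R).
    rewrite ler_nat; apply: subset_leq_card.
    by apply: subset_trans (ball_in_gball _ _ _) (gball_sub _ _ _); lia.
  apply: le_trans vk _; rewrite ler_expR -mulrA ler_pM2l //.
  by rewrite ler_pdivrMr // -natrM ler_nat; lia.
exists j; first by lia.
rewrite -/(f j) -/(f j.+1).
have fj' : expR (- beta) * f j.+1 <= f j.
  by rewrite -(ler_pM2l (expR_gt0 beta)) mulrA -expRD subrr expR0 mul1r.
(* With $1 - \beta \le e^{-\beta}$ this yields $(1 - \beta) f(j+1) \le f(j)$. *)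
have := expR_ge1Dx (- beta); have : 0 <= f j.+1 by rewrite /f.
nra.
Qed.

(** Carving out a slowly growing ball [B'] around [B] costs at most $|B| + d|B' \setminus B| \le (1
    + d\beta)|B'|$ edges. The hypothesis concerns balls of [G], so it passes to the remaining set,
    and induction on its size applies. *)
Lemma kept_edges_good k (Q : {set V * V}) (S : {set V}) :
  presentation G Q -> (0 < k)%N ->
  (forall v, v \in S -> #|gball G k v|%:R <= expR (beta * k%:R / 2)) ->
  #|[set q in kept_edges Q (kruskal_answer G id k) |
      (q.1 \in S) && (q.2 \in S)]|%:R <= (1 + d%:R * beta) * #|S|%:R.
Proof.
move=> Qpres k0; set E := kept_edges _ _.
move: {2}(#|S|) (leqnn #|S|) => n; elim: n S => [|n IHn] S Sn Sgood.
  have S0 : S = set0 by apply/eqP; rewrite -cards_eq0 -leqn0.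
  rewrite S0 cards0 mulr0 (_ : finset _ = set0) ?cards0 //.
  by apply/setP => q; rewrite !inE !andbF.
have [S0|[v vS]] := set_0Vmem S.
  by apply: IHn => //; rewrite S0 cards0.
have [j jk slow] := ball_in_slow_growth S k0 (Sgood v vS).
pose B := ball_in S j v; pose B' := ball_in S j.+1 v.
have BB' : B \subset B' by apply: subsetUl.
have B'S : B' \subset S by apply: ball_in_sub.
have cardD : (#|B' :\: B| = #|B'| - #|B|)%N by rewrite cardsD (setIidPr BB').
(* Neighbours of [B] in [S] lie in [B']; so an edge inside [S] is inside [B], meets the shell, or
   avoids [B']. *)
have cover : [set q in E | (q.1 \in S) && (q.2 \in S)] \subset
    [set q in E | (q.1 \in B) && (q.2 \in B)] :|:
    ([set q in Q | (q.1 \in B' :\: B) || (q.2 \in B' :\: B)] :|: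
    [set q in E | (q.1 \in S :\: B') && (q.2 \in S :\: B')]).
  have step a b : a \in B -> b \in S -> G a b -> b \in B'.
    move=> aB bS ab; rewrite /B' /= !inE bS /=; apply/orP; right.
    by apply/existsP; exists a; rewrite aB.
  clearbody B B'.
  apply/subsetP => -[a b]; rewrite !inE /= => /andP[/andP[abQ ->] /andP[aS bS]].
  have Gab := Qpres.1 _ _ abQ.
  have Gba : G b a by rewrite adj_sym.
  rewrite abQ aS bS /= !andbT.
  have := step a b; have := step b a; rewrite Gab Gba aS bS.
  have := subsetP BB' a; have := subsetP BB' b.
  by case: (a \in B); case: (b \in B);
    case: (a \in B'); case: (b \in B') => //=; auto.
have := leq_trans (subset_leq_card cover) (leq_card_setU _ _).
move=> /leq_trans /(_ (leq_add (leqnn _) (leq_card_setU _ _))).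
(* Two vertices of [B] are joined through the centre [v] by a walk of length at most $2j \le k$. *)
have inB : (#|[set q in E | (q.1 \in B) && (q.2 \in B)]| <= #|B|)%N.
  apply: card_kept_edges_in => // u w uB wB.
  apply: (subsetP (gball_sub _ _ jk)); rewrite -addnn.
  apply: (gball_trans (v := v)); first rewrite gball_sym.
    exact: (subsetP (ball_in_gball S j v)).
  exact: (subsetP (ball_in_gball S j v)).
have inD := card_incident_edges (B' :\: B) Qpres.
have inS : #|[set q in E | (q.1 \in S :\: B') && (q.2 \in S :\: B')]|%:R
    <= (1 + d%:R * beta) * #|S :\: B'|%:R.
  apply: IHn => [|u]; last by rewrite inE => /andP[_ /Sgood].
  rewrite -ltnS; apply: leq_trans Sn; apply: proper_card.
  rewrite properE subsetDl; apply/subsetPn; exists v => //.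
  by rewrite in_setD ball_in_refl.
rewrite -(ler_nat R) !natrD => total.
apply: le_trans total _.
move: inB inD; rewrite -!(ler_nat R) natrM => inB inD.
have cS : #|S|%:R = #|S :\: B'|%:R + #|B'|%:R :> R.
  by rewrite -natrD cardsD (setIidPr B'S) subnK ?subset_leq_card.
have cD : #|B' :\: B|%:R = #|B'|%:R - #|B|%:R :> R.
  by rewrite cardD natrB ?subset_leq_card.
have cBB' : #|B|%:R <= #|B'|%:R :> R by rewrite ler_nat subset_leq_card.
have dD : d%:R * #|B' :\: B|%:R <= d%:R * (beta * #|B'|%:R) :> R.
  by rewrite ler_wpM2l // cD.
rewrite cS mulrDr [X in _ <= X]addrC.
rewrite addrA; apply: lerD => //.
rewrite mulrDl mul1r -mulrA.
by apply: lerD; [exact: le_trans inB cBB'|exact: le_trans inD dD].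
Qed.

(** The good vertices account for at most $(1 + d\beta)|V|$ edges and the others for at most
    $d\alpha|V|$, where $d(\alpha + \beta) = \epsilon$. The count is made at the minimal depth [k0],
    which is admissible, whereas [k] may fail to be. *)
Lemma kruskal_sparse (alpha_gt0 : 0 < alpha) (eps : R) k (Q : {set V * V}) :
  (0 < d)%N -> alpha + beta = eps / d%:R ->
  (kK G alpha_gt0 beta_gt0 <= k)%N -> presentation G Q ->
  #|kept_edges Q (kruskal_answer G id k)|%:R <= (1 + eps) * #|V|%:R.
Proof.
move=> d0 epsE + Qpres; rewrite /kK.
case: ex_minnP => k0 /andP[k0_gt0 adm] _ k0k.
set S := finset _ in adm.
have sub : kept_edges Q (kruskal_answer G id k) \subset
    [set q in kept_edges Q (kruskal_answer G id k0) |
      (q.1 \in S) && (q.2 \in S)] :|: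
    [set q in Q | (q.1 \in ~: S) || (q.2 \in ~: S)].
  apply/subsetP => -[a b]; rewrite inE => /andP[abQ ans].
  rewrite in_setU !in_set abQ (kruskal_answer_sub k0k ans) /=.
  by case: (_ <= _) => //=; case: (_ <= _).
have := leq_trans (subset_leq_card sub) (leq_card_setU _ _).
have inS := @kept_edges_good k0 Q S Qpres k0_gt0.
have {}inS := inS (fun v => ltac:(by rewrite inE)).
have inC := card_incident_edges (~: S) Qpres.
rewrite -(ler_nat R) natrD => total; apply: le_trans total _.
move: inC; rewrite -(ler_nat R) natrM => inC.
have cV : #|V|%:R = #|S|%:R + #|~: S|%:R :> R by rewrite -natrD cardsC.
have epsE' : eps = d%:R * alpha + d%:R * beta.
  by rewrite -mulrDr epsE mulrCA divff ?mulr1 // pnatr_eq0 -lt0n.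
have SV : #|S|%:R <= #|V|%:R :> R by rewrite ler_nat max_card.
have cC : #|~: S|%:R <= alpha * #|V|%:R.
  by move: adm; rewrite mulrBl mul1r; lra.
have dC : d%:R * #|~: S|%:R <= d%:R * (alpha * #|V|%:R) by rewrite ler_wpM2l.
have dS : (1 + d%:R * beta) * #|S|%:R <= (1 + d%:R * beta) * #|V|%:R.
  by rewrite ler_wpM2l // addr_ge0 // mulr_ge0 // ltW.
apply: le_trans (lerD (le_trans inS dS) (le_trans inC dC)) _.
by rewrite epsE' mulrA -mulrDl ler_wpM2r //; lra.
Qed.

End Sparsity.

(** * Running time and correctness of the program *)

Section Runs.
Variables (V : eqType) (inc : V -> seq V).
Variables (disp : Order.disp_t) (I : orderType disp) (id : V -> I).
Implicit Types (c : cmd) (s : state V) (P : state V -> Prop).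

(** Each query itself costs time, so the triples below track time only. *)
Lemma exec_queries_le_time c s s' q t : exec inc id c s s' q t -> q <= t.
Proof. by elim=> {c s s' q t} *; lia. Qed.

(** A total-correctness triple with time bound [n]. Nested in the postcondition [P], it lets a
    sequence of commands be executed symbolically from left to right. *)
Definition runs c s n P : Prop :=
  exists s' q t, [/\ exec inc id c s s' q t, t <= n & P s'].

Lemma runs_le c s m n P P' : m <= n -> (forall s', P s' -> P' s') ->
  runs c s m P -> runs c s n P'.
Proof.
move=> mn PP' [s' [q [t [st tm Ps]]]]; exists s', q, t.
by split=> //; [exact: leq_trans tm mn|exact: PP'].
Qed.

Lemma runs_seq c1 c2 s m n P :
  runs c1 s m (fun s1 => runs c2 s1 n P) -> runs (CSeq c1 c2) s (m + n) P.
Proof.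
move=> [s1 [q1 [t1 [st1 t1m [s2 [q2 [t2 [st2 t2n Ps]]]]]]]].
exists s2, (q1 + q2), (t1 + t2); split=> //; first exact: exec_seq st1 st2.
exact: leq_add.
Qed.

(** The invariant carries an iteration counter which stays below [N] while the test succeeds; the
    last summand pays for the final, failing test. *)
Lemma runs_while (Inv : nat -> state V -> Prop) b c N m i s :
  (forall j s1, Inv j s1 -> eval_test id s1 b ->
    j < N /\ runs c s1 m (Inv j.+1)) ->
  Inv i s ->
  runs (CWhile b c) s ((N - i) * (m + (test_size b).+1) + (test_size b).+1)
    (fun s' => ~~ eval_test id s' b /\ exists j, Inv j s').
Proof.
move=> step; move: {2}(N - i) (leqnn (N - i)) => n.
elim: n i s => [|n IHn] i s Nin inv_s;
  case: (boolP (eval_test id s b)) => [test_s|stop]; last 1 first.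
- exists s, 0, (test_size b).+1.
  split; [exact: exec_while_stop|exact: leq_addl|].
  by split=> //; exists i.
- by have [iN _] := step _ _ inv_s test_s; lia.
- exists s, 0, (test_size b).+1.
  split; [exact: exec_while_stop|exact: leq_addl|].
  by split=> //; exists i.
have [iN [s1 [q1 [t1 [st1 t1m inv_s1]]]]] := step _ _ inv_s test_s.
have [|s2 [q2 [t2 [st2 t2m inv_s2]]]] := IHn i.+1 s1 _ inv_s1; first by lia.
exists s2, (q1 + q2), (test_size b + t1 + t2).+1; split=> //.
  exact: exec_while_step st1 st2.
have -> : N - i = (N - i.+1).+1 by lia.
by rewrite mulSn; lia.
Qed.

Fixpoint loop_free c : bool :=
  match c with
  | CWhile _ _ => false
  | CSeq c1 c2 | CIf _ c1 c2 => loop_free c1 && loop_free c2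
  | _ => true
  end.

(* An upper bound: both branches of a conditional are counted. *)
Fixpoint cost c : nat :=
  match c with
  | CSet _ e => (expr_size e).+1
  | CPut _ e f | CAsk _ e f => (expr_size e + expr_size f).+1
  | CSeq c1 c2 => cost c1 + cost c2
  | CIf b c1 c2 => (test_size b + (cost c1 + cost c2)).+1
  | CWhile _ _ => 0
  end.

(** An interpreter for loop-free code, so that such code is run by computation; the value at a loop
    is a mere default. *)
Fixpoint eval_cmd c s : state V :=
  match c with
  | CSet x e => set_var s x (eval_expr s e)
  | CPut a e f => Defs.set_mem s a (eval_expr s e) (eval_expr s f)
  | CAsk x e f => set_var s x (query inc (eval_expr s e) (eval_expr s f))
  | CSeq c1 c2 => eval_cmd c2 (eval_cmd c1 s)
  | CIf b c1 c2 => if eval_test id s b then eval_cmd c1 s else eval_cmd c2 s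
  | CWhile _ _ => s
  end.

Lemma runs_loop_free c s P :
  loop_free c -> P (eval_cmd c s) -> runs c s (cost c) P.
Proof.
move=> lf Ps; suff [q [t [st tc]]] : exists q t,
    exec inc id c s (eval_cmd c s) q t /\ t <= cost c.
  by exists (eval_cmd c s), q, t.
elim: c s lf {P Ps} => //=.
- by move=> x e s _; do 2!eexists; split; first exact: exec_set.
- by move=> x e f s _; do 2!eexists; split; first exact: exec_put.
- by move=> x e f s _; do 2!eexists; split; first exact: exec_ask.
- move=> c1 IH1 c2 IH2 s /andP[/(IH1 s)[q1 [t1 [st1 t1c]]]].
  move=> /(IH2 (eval_cmd c1 s))[q2 [t2 [st2 t2c]]].
  exists (q1 + q2), (t1 + t2); split; first exact: exec_seq st1 st2.
  exact: leq_add.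
- move=> b c1 IH1 c2 IH2 s /andP[/(IH1 s)[q1 [t1 [st1 t1c]]]].
  move=> /(IH2 s)[q2 [t2 [st2 t2c]]].
  case bs: (eval_test id s b).
    exists q1, (test_size b + t1).+1.
    by split; [apply: exec_if; rewrite bs|lia].
  exists q2, (test_size b + t2).+1.
  by split; [apply: exec_if; rewrite bs|lia].
Qed.

Definition num (n : nat) : word V := Some (inl n).
Definition ver (v : V) : word V := Some (inr v).

Arguments num : simpl never.
Arguments ver : simpl never.

Lemma eq_num m n : (num m == num n) = (m == n).
Proof. by []. Qed.

Lemma eq_ver u v : (ver u == ver v) = (u == v).
Proof. by []. Qed.

End Runs.

(** * The breadth-first search to depth [k] *)

Section Bfs.
Variables (V : finType) (G : sgraph V) (inc : V -> seq V).
Hypothesis incP : incidence_lists G inc.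
Variables (disp : Order.disp_t) (I : orderType disp) (id : V -> I).
Variables (k : nat) (x y : V).
Local Notation num := (@num V).
Local Notation ver := (@ver V).

(* The distance from x, truncated at k + 1. *)
Definition tdist (w : V) : nat :=
  find (fun m => w \in gball G m x) (iota 0 k.+1).

Lemma tdist_le w m : m <= k -> (tdist w <= m) = (w \in gball G m x).
Proof.
move=> mk; apply/idP/idP => [le_wm|wm].
  have /(nth_find 0) : has (fun m => w \in gball G m x) (iota 0 k.+1).
    by rewrite has_find size_iota; apply: leq_ltn_trans le_wm _.
  rewrite nth_iota ?add0n; last by apply: leq_ltn_trans le_wm _.
  exact: (subsetP (gball_sub _ _ le_wm)).
rewrite leqNgt; apply/negP => /(before_find 0).
by rewrite nth_iota ?add0n ?wm.
Qed.

Lemma tdistx : tdist x = 0.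
Proof. by apply/eqP; rewrite -leqn0 tdist_le // gball_refl. Qed.

Lemma tdist_edge u w : tdist u < k -> G u w -> tdist w <= (tdist u).+1.
Proof.
move=> uk uw; rewrite tdist_le //; apply: edge_gball uw.
by rewrite -tdist_le // ltnW.
Qed.

Lemma tdist_pred w m : tdist w <= m.+1 -> m < k ->
  w = x \/ exists2 u, tdist u <= m & G u w.
Proof.
move=> + mk; rewrite tdist_le // => /gballSP[|[u um uw]]; first by left.
by right; exists u => //; rewrite tdist_le // ltnW.
Qed.

(** The queue invariant, apart from the memory, when the first [h] entries have been processed. By
    [bfs_sorted] and [bfs_front] the pending entries span at most two consecutive levels. *)
Record bfs_order (h : nat) (qs : seq V) : Prop := BfsOrder {
  bfs_head : h <= size qs;
  bfs_uniq : uniq qs;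
  bfs_root : x \in qs;
  bfs_le_k : forall w, w \in qs -> tdist w <= k;
  bfs_sorted : pairwise (fun a b => tdist a <= tdist b) qs;
  bfs_front : forall u w,
    u \in drop h qs -> w \in qs -> tdist w <= (tdist u).+1;
  bfs_closed : forall u w,
    u \in take h qs -> tdist u < k -> G u w -> w \in qs }.

Lemma bfs_order_init : bfs_order 0 [:: x].
Proof.
split=> //; first by rewrite mem_head.
- by move=> w; rewrite inE => /eqP->; rewrite tdistx.
- by move=> u w; rewrite !inE => /eqP-> /eqP->; rewrite tdistx.
Qed.

Lemma bfs_order_head h qs w : bfs_order h qs -> h < size qs ->
  w \in drop h qs -> tdist (nth x qs h) <= tdist w.
Proof.
move=> ord hq; rewrite (drop_nth x hq) inE => /orP[/eqP->//|wh].
have := bfs_sorted ord; rewrite -{1}(cat_take_drop h qs) pairwise_cat.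
by rewrite (drop_nth x hq) /= => /and4P[_ _ /allP/(_ w wh)].
Qed.

(** By induction on the distance: a predecessor of [w] is nearer than the head, hence enqueued and
    no longer pending, so [bfs_closed] applies. Consequently a vertex discovered from the head lies
    exactly one level further. *)
Lemma bfs_order_level h qs w : bfs_order h qs -> h < size qs ->
  tdist w <= tdist (nth x qs h) -> w \in qs.
Proof.
move=> ord hq; set u := nth x qs h.
have uk : tdist u <= k by apply: (bfs_le_k ord); apply: mem_nth.
move: {2}(tdist w) (leqnn (tdist w)) => m; elim: m w => [|m IHm] w wm wu.
  move: wm; rewrite tdist_le // gball0 inE => /eqP->; exact: bfs_root ord.
have [wm'|mw] := leqP (tdist w) m; first exact: IHm.
have mu : m < tdist u by apply: leq_trans mw wu.
have [->|[p pm pw]] := tdist_pred wm (leq_trans mu uk).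
  exact: bfs_root ord.
have pu : tdist p < tdist u by apply: leq_ltn_trans pm mu.
have pq : p \in qs by apply: IHm => //; apply: ltnW.
apply: (bfs_closed ord) pw; last exact: leq_trans pu uk.
move: pq; rewrite -{1}(cat_take_drop h qs) mem_cat => /orP[//|ph].
by have := bfs_order_head ord hq ph; rewrite leqNgt pu.
Qed.

Lemma bfs_order_step h qs ex (u := nth x qs h) :
  bfs_order h qs -> h < size qs -> uniq (qs ++ ex) ->
  (forall w, w \in ex -> tdist u < k /\ tdist w = (tdist u).+1) ->
  (forall w, tdist u < k -> G u w -> w \in qs ++ ex) ->
  bfs_order h.+1 (qs ++ ex).
Proof.
move=> ord hq uq exu nbu.
have uh : u \in drop h qs by rewrite (drop_nth x hq) mem_head.
have wu w : w \in qs ++ ex -> tdist w <= (tdist u).+1.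
  by rewrite mem_cat => /orP[/(bfs_front ord uh)|/exu[_ ->]].
split=> //.
- by rewrite size_cat (leq_trans hq) // leq_addr.
- by rewrite mem_cat (bfs_root ord).
- by move=> w; rewrite mem_cat => /orP[/(bfs_le_k ord)|/exu[uk ->]].
- rewrite pairwise_cat (bfs_sorted ord) /=; apply/andP; split.
    apply/allrelP => a b aq /exu[_ ->]; apply: wu.
    by rewrite mem_cat aq.
  apply/(pairwiseP x) => i j; rewrite !inE => iex jex _.
  by rewrite (exu _ (mem_nth x iex)).2 (exu _ (mem_nth x jex)).2.
- move=> a w ah /wu/leq_trans; apply; rewrite ltnS.
  move: ah; rewrite drop_cat; case: ltnP => [hq'|_].
    rewrite mem_cat => /orP[ah|/exu[_ ->//]].
    apply: (bfs_order_head ord hq); apply: (@mem_drop 1).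
    by rewrite drop_drop add1n.
  by move/mem_drop => /exu[_ ->].
- move=> a w; rewrite take_cat; case: ltnP => [hq'|qh].
    rewrite (take_nth x hq) mem_rcons inE => /orP[/eqP->|ah]; first exact: nbu.
    by move=> ak aw; rewrite mem_cat (bfs_closed ord ah).
  (* Here [size qs = h.+1]: the processed prefix is all of [qs] and nothing of [ex]. *)
  have -> : h.+1 - size qs = 0 by lia.
  rewrite take0 cats0 -{1}(cat_take_drop h qs) mem_cat (drop_nth x hq).
  rewrite drop_oversize // inE => /orP[ah|/eqP->]; last exact: nbu.
  by move=> ak aw; rewrite mem_cat (bfs_closed ord ah).
Qed.

Lemma bfs_order_final qs : bfs_order (size qs) qs -> qs =i gball G k x.
Proof.
move=> ord w; apply/idP/idP => [wq|].
  by rewrite -tdist_le //; apply: (bfs_le_k ord).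
move=> wk; suff all m u : m <= k -> u \in gball G m x -> u \in qs.
  exact: all wk.
elim: m u => [|m IHm] u mk.
  by rewrite gball0 inE => /eqP->; apply: bfs_root ord.
move=> /gballSP[->|[p pm]]; first exact: bfs_root ord.
apply: (bfs_closed ord); last first.
  by apply: leq_ltn_trans (mk); rewrite tdist_le ?(ltnW mk).
by rewrite take_size IHm // ltnW.
Qed.

Definition entry (u : V) (i : nat) : word V := omap inr (onth (inc u) i).

Lemma entry_nth u i : i < size (inc u) -> entry u i = ver (nth x (inc u) i).
Proof. by move=> iu; rewrite /entry onthE (nth_map x). Qed.

Lemma entry_default u i : size (inc u) <= i -> entry u i = None.
Proof. by move=> iu; rewrite /entry onth_default. Qed.

(** The case [i = size (inc u)] is the empty cell that terminates the stored list. *)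
Definition stored (s : state V) (u : V) (st : nat) : Prop :=
  cell s aStart (ver u) = num st /\
  forall i, i <= size (inc u) -> cell s aList (num (st + i)) = entry u i.

Record bfs_mem (s : state V) (qs : seq V) : Prop := BfsMem {
  mem_X : reg s vX = ver x;
  mem_Y : reg s vY = ver y;
  mem_K : reg s vK = num k;
  mem_tail : reg s vTail = num (size qs);
  mem_queue : forall i, i < size qs -> cell s aQueue (num i) = ver (nth x qs i);
  mem_dist : forall w, cell s aDist (ver w) =
    if w \in qs then num (tdist w) else None;
  mem_seen : forall w, cell s aSeen (ver w) = None }.

(** The strict inequality before [f], the first free cell, protects the terminators of the stored
    lists from later writes. *)
Definition bfs_inv (h : nat) (s : state V) : Prop :=
  exists qs f,
  [/\ bfs_mem s qs, bfs_order h qs, reg s vHead = num h /\ reg s vFree = num f,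
      forall i, f <= i -> cell s aList (num i) = None
    & forall u, u \in take h qs ->
        exists2 st, st + size (inc u) < f & stored s u st].

(* While the incidence list of the (h+1)-st vertex u of the queue qs is
   scanned, i neighbours having been read, the vertices ex were appended. *)
Record bfs_scan (qs : seq V) (h f i : nat) (s : state V) (ex : seq V)
    (u := nth x qs h) : Prop := BfsScan {
  scan_mem : bfs_mem s (qs ++ ex);
  scan_head : reg s vHead = num h.+1;
  scan_free : reg s vFree = num (f + i);
  scan_U : reg s vU = ver u;
  scan_I : reg s vI = num i;
  scan_W : reg s vW = entry u i;
  scan_i : i <= size (inc u);
  scan_start : cell s aStart (ver u) = num f;
  scan_list : forall j, j < i -> cell s aList (num (f + j)) = entry u j;
  scan_fresh : forall j, f + i <= j -> cell s aList (num j) = None;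
  scan_stored : forall v, v \in take h qs ->
    exists2 st, st + size (inc v) < f & stored s v st;
  scan_uniq : uniq (qs ++ ex);
  scan_ex : forall w, w \in ex -> tdist u < k /\ tdist w = (tdist u).+1;
  scan_nb : forall w, tdist u < k -> w \in take i (inc u) -> w \in qs ++ ex }.

(** Read off from the program by matching, so that it agrees with the actual loop body by
    computation; the default branch is not reached. *)
Definition bfs_inner_body : cmd :=
  if bfs_prog is
    CSeq _ (CSeq _ (CSeq _ (CSeq _ (CSeq _ (CWhile _
      (CSeq _ (CSeq _ (CSeq _ (CSeq _ (CSeq _ (CSeq (CWhile _ c) _)))))))))))
  then c else bfs_prog.

Lemma bfs_inner_step qs h f i s ex :
  bfs_order h qs -> h < size qs -> i < size (inc (nth x qs h)) ->
  bfs_scan qs h f i s ex ->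
  exists ex', bfs_scan qs h f i.+1 (eval_cmd inc id bfs_inner_body s) ex'.
Proof.
move=> ord hq; set u := nth x qs h => iu sc.
have M := scan_mem sc.
have wE := entry_nth iu; set w := nth x (inc u) i in wE.
have Guw : G u w by rewrite -(incP u).2 mem_nth.
have uq : u \in qs by apply: mem_nth.
have uqe : u \in qs ++ ex by rewrite mem_cat uq.
have tw : take i.+1 (inc u) = rcons (take i (inc u)) w.
  by rewrite (take_nth x iu).
(* The contents of [aList] after [w] is written to cell [f + i], beyond all lists stored earlier. *)
pose lst a := if a == num (f + i) then ver w else cell s aList a.
have lst_u j : j < i.+1 -> lst (num (f + j)) = entry u j.
  rewrite /lst eq_num eqn_add2l ltnS leq_eqVlt; case: eqP => [->//|_ /= ji].
  exact: scan_list sc j ji.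
have lst_fresh j : f + i.+1 <= j -> lst (num j) = None.
  rewrite addnS /lst eq_num => fij; rewrite gtn_eqF //.
  exact/(scan_fresh sc)/ltnW.
have lst_old v : v \in take h qs -> exists2 st, st + size (inc v) < f &
    cell s aStart (ver v) = num st /\
    forall j, j <= size (inc v) -> lst (num (st + j)) = entry v j.
  move=> /(scan_stored sc)[st stf [st_v lst_v]]; exists st => //.
  split=> // j jv.
  by rewrite /lst eq_num ltn_eqF ?lst_v //; lia.
have nextW : query inc (reg s vU) (num i.+1) = entry u i.+1.
  by rewrite (scan_U sc).
rewrite /= (scan_W sc) -/u wE (scan_U sc) -/u !(mem_dist M) uqe (mem_K M).
have -> : ((if w \in qs ++ ex then num (tdist w) else None) == None) =
  (w \notin qs ++ ex) by case: ifP.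
rewrite [word_lt _ _ _]/=.
case: (boolP ((w \notin qs ++ ex) && (tdist u < k))) => [/andP[wq uk]|old] /=.
  (* Were [w] no farther than [u], it would already be in the queue. *)
  have wd : tdist w = (tdist u).+1.
    apply/eqP; rewrite eqn_leq tdist_edge // ltnNge; apply: contra wq => wu.
    by rewrite mem_cat (bfs_order_level ord hq).
  exists (rcons ex w).
  rewrite (scan_free sc) (scan_I sc) (mem_tail M).
  split=> //=; rewrite -?rcons_cat -/u.
  - split=> //=; try by case: M.
    + by rewrite size_rcons.
    + move=> j; rewrite size_rcons ltnS leq_eqVlt eq_num nth_rcons.
      case: eqP => [->|_ /= jq]; first by rewrite ltnn.
      by rewrite jq (mem_queue M).
    + move=> v; rewrite mem_rcons inE eq_ver; case: eqP => [->|_] /=.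
        by rewrite wd.
      exact: mem_dist M v.
  - exact: scan_head sc.
  - by rewrite addnS.
  - exact: scan_U sc.
  - exact: scan_start sc.
  - by rewrite rcons_uniq wq (scan_uniq sc).
  - by move=> v; rewrite mem_rcons inE => /orP[/eqP->//|/(scan_ex sc)].
  - move=> v _; rewrite tw !mem_rcons !inE => /orP[->//|vi].
    by rewrite (scan_nb sc) ?orbT.
exists ex; rewrite (scan_free sc) (scan_I sc); split=> //=.
- by split=> //=; case: M.
- exact: scan_head sc.
- by rewrite addnS.
- exact: scan_U sc.
- exact: scan_start sc.
- exact: scan_uniq sc.
- exact: scan_ex sc.
- move=> v uk; rewrite tw mem_rcons inE => /orP[/eqP->|/(scan_nb sc uk)//].
  by move: old; rewrite -/u uk andbT negbK.
Qed.

Definition bfs_body : cmd :=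
  if bfs_prog is CSeq _ (CSeq _ (CSeq _ (CSeq _ (CSeq _ (CWhile _ c)))))
  then c else bfs_prog.

(** The queue is a duplicate-free list of vertices of the ball, which bounds [h]; one round scans at
    most [d] neighbours at constant cost each. *)
Lemma runs_bfs_body d h s : degree_bounded G d -> 0 < d -> bfs_inv h s ->
  eval_test id s (TLt (EVar vHead) (EVar vTail)) ->
  h < #|gball G k x| /\ runs inc id bfs_body s (300 * d) (bfs_inv h.+1).
Proof.
move=> Gd d0 [qs [f [M ord [hH hF] fresh st]]] /=.
rewrite hH (mem_tail M) /= => hq.
have qk : size qs <= #|gball G k x|.
  rewrite -(card_uniqP (bfs_uniq ord)); apply: subset_leq_card.
  by apply/subsetP => w wq; rewrite -tdist_le // (bfs_le_k ord).
split; first exact: leq_trans hq qk.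
set u := nth x qs h.
have ud : size (inc u) <= d.
  apply: leq_trans (Gd u); rewrite -(card_uniqP (incP u).1).
  by apply: subset_leq_card; apply/subsetP => w; rewrite inE (incP u).2.
(* Hence writing the start address of [u] disturbs no address recorded earlier. *)
have old v : v \in take h qs -> (u == v) = false.
  move=> vh; apply/eqP => uv; have := bfs_uniq ord.
  rewrite -(cat_take_drop h qs) cat_uniq (drop_nth x hq) -/u uv.
  by move=> /and3P[_ /hasPn/(_ v)]; rewrite mem_head vh => /(_ isT).
have inner s1 : bfs_scan qs h f 0 s1 [::] ->
  runs inc id (CWhile (TNot (TEq (EVar vW) ENil)) bfs_inner_body) s1
    (d * 100 + 10) (fun s2 => exists ex, bfs_scan qs h f (size (inc u)) s2 ex).
  move=> sc; pose Inv i s2 := exists ex, bfs_scan qs h f i s2 ex.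
  have step i s2 : Inv i s2 -> eval_test id s2 (TNot (TEq (EVar vW) ENil)) ->
      i < size (inc u) /\
      runs inc id bfs_inner_body s2 (cost bfs_inner_body) (Inv i.+1).
    move=> [ex sc2] /= W; have iu : i < size (inc u).
      rewrite ltnNge; apply: contra W => iu.
      by rewrite (scan_W sc2) entry_default.
    split=> //; apply: runs_loop_free => //.
    exact: bfs_inner_step sc2.
  have := runs_while step (ex_intro _ [::] sc).
  apply: runs_le => [|s2 [/negPn/eqP W [i [ex sc2]]]].
    rewrite subn0 /=; lia.
  exists ex; suff <- : i = size (inc u) by [].
  apply/eqP; rewrite eqn_leq (scan_i sc2) leqNgt; apply/negP => iu.
  by have := scan_W sc2; rewrite -/u entry_nth // [reg _ _]W.
have sc0 : bfs_scan qs h f 0 (eval_cmd inc id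
    (CSeq (CSet vU (EGet aQueue (EVar vHead)))
    (CSeq (CSet vHead (ESuc (EVar vHead)))
    (CSeq (CPut aStart (EVar vU) (EVar vFree))
    (CSeq (CSet vI (ECst 0)) (CAsk vW (EVar vU) (EVar vI)))))) s) [::].
  rewrite /= hH (mem_queue M) //; split=> //=; rewrite ?cats0 -/u.
  - by split=> //=; case: M.
  - by rewrite addn0 hF.
  - by rewrite eqxx.
  - by rewrite addn0.
  - move=> v vh; have [st' st'f [st_v lst_v]] := st v vh.
    exists st' => //; split=> //=.
    by rewrite eq_ver eq_sym (old v vh).
  - exact: bfs_uniq ord.
  - by rewrite take0.
have final s2 ex : bfs_scan qs h f (size (inc u)) s2 ex ->
    bfs_inv h.+1 (eval_cmd inc id (CSet vFree (ESuc (EVar vFree))) s2).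
  move=> sc; exists (qs ++ ex), (f + size (inc u)).+1; split=> /=.
  - by split=> //=; case: (scan_mem sc).
  - apply: (bfs_order_step ord hq) => [||w uk uw].
    + exact: scan_uniq sc.
    + exact: scan_ex sc.
    + by apply: (scan_nb sc) => //; rewrite take_size (incP u).2.
  - by rewrite (scan_head sc) (scan_free sc).
  - by move=> i fi; apply: (scan_fresh sc); apply: ltnW.
  - move=> v vh.
    have {}vh : v \in rcons (take h qs) u.
      move: vh; rewrite -take_nth // take_cat; case: ltnP => // qh.
      have -> : h.+1 - size qs = 0 by lia.
      by rewrite take0 cats0 take_oversize.
    move: vh; rewrite mem_rcons inE => /orP[/eqP->|vh].
      exists f; first by rewrite ltnS.
      split=> [|i iu]; first exact: scan_start sc.
      move: iu; rewrite leq_eqVlt => /orP[/eqP->|iu]; last first.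
        exact: scan_list sc _ iu.
      by rewrite entry_default //; apply: scan_fresh sc _ _.
    have [st' st'f st_v] := scan_stored sc vh; exists st' => //.
    by apply: leq_trans st'f _; lia.
(* The exact time bound is left open, filled in by the symbolic execution, and compared with
   [300 * d] at the end. *)
eapply (runs_le _ (fun _ Hs => Hs)).
  do 5![apply: runs_seq; apply: runs_loop_free => //].
  apply: runs_seq; apply: (runs_le (leqnn _)) (inner _ sc0) => s2 [ex sc].
  by apply: runs_loop_free => //; apply: final sc.
Unshelve.
rewrite /=; lia.
Qed.

Lemma runs_bfs d : degree_bounded G d -> 0 < d ->
  runs inc id bfs_prog (init_state k x y) (500 * (d * #|gball G k x|))
    (fun s => exists2 qs : seq V, qs =i gball G k x & bfs_mem s qs /\
       forall u, u \in qs -> exists st, stored s u st).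
Proof.
move=> Gd d0; have B0 : 0 < #|gball G k x|.
  by apply/card_gt0P; exists x; apply: gball_refl.
have inv0 : bfs_inv 0 (eval_cmd inc id (CSeq (CSet vHead (ECst 0))
   (CSeq (CSet vTail (ECst 1)) (CSeq (CSet vFree (ECst 0))
   (CSeq (CPut aQueue (ECst 0) (EVar vX)) (CPut aDist (EVar vX) (ECst 0))))))
   (init_state k x y)).
  exists [:: x], 0; split=> //=.
  - split=> //=.
    + by case.
    + by move=> w; rewrite inE eq_ver; case: eqP => [->|//]; rewrite tdistx.
  - exact: bfs_order_init.
eapply (runs_le _ _).
  do 5![apply: runs_seq; apply: runs_loop_free => //].
  apply: (runs_while (fun h s => @runs_bfs_body d h s Gd d0) inv0).
Unshelve.
  by rewrite /= subn0; nia.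
move=> s /= [stop [h [qs [f [M ord [hH _] _ st]]]]].
have hq : h = size qs.
  move: stop; rewrite hH (mem_tail M) /= -leqNgt => qh.
  by apply/eqP; rewrite eqn_leq (bfs_head ord).
rewrite hq in ord st; exists qs; first exact: bfs_order_final.
split=> // u uq.
by have [|st' _] := st u; [rewrite take_size|exists st'].
Qed.

(** * The second search: reachability of [y] by edges of smaller rank *)

Hypothesis id_inj : injective id.
Hypothesis Gxy : G x y.
Local Notation B := (gball G k x).
Local Notation L := (light G id k x y).

(** The program handles vertices rather than ids: [lo] and [hi] are the ends as [sort_prog] arranges
    them. *)
Definition lo (u w : V) : V := if (id w < id u)%O then w else u.
Definition hi (u w : V) : V := if (id w < id u)%O then u else w.

Lemma rank_ltE u w a b : rank_lt id (u, w) (a, b) =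
  (id (lo u w) < id (lo a b))%O ||
  (lo u w == lo a b) && (id (hi u w) < id (hi a b))%O.
Proof.
have lowE c c' : Order.min (id c) (id c') = id (lo c c').
  by rewrite /lo; case: ltgtP.
have hiE c c' : Order.max (id c) (id c') = id (hi c c').
  by rewrite /hi; case: ltgtP.
by rewrite /rank_lt /= !lowE !hiE (inj_eq id_inj).
Qed.

Record search_mem (s : state V) (qs : seq V) : Prop := SearchMem {
  search_Y : reg s vY = ver y;
  search_lo : reg s vLoXY = ver (lo x y);
  search_hi : reg s vHiXY = ver (hi x y);
  search_dist : forall w, (cell s aDist (ver w) == None) = (w \notin B);
  search_stored : forall u, u \in B -> exists st, stored s u st;
  search_tail : reg s vTail = num (size qs);
  search_queue : forall i, i < size qs ->
    cell s aQueue2 (num i) = ver (nth x qs i);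
  search_seen : forall w, cell s aSeen (ver w) =
    if w \in qs then num 1 else None;
  search_uniq : uniq qs;
  search_root : x \in qs;
  search_sub : forall w, w \in qs -> w \in B /\ connect L x w }.

(** Soundness of the search is [search_sub]; completeness comes from the closure of the processed
    prefix under [L], once the queue is exhausted. *)
Definition search_inv (h : nat) (s : state V) : Prop :=
  exists qs, [/\ search_mem s qs, reg s vHead = num h, h <= size qs
    & forall u w, u \in take h qs -> L u w -> w \in qs].

Record search_scan (qs : seq V) (h st i : nat) (s : state V) (ex : seq V)
    (u := nth x qs h) : Prop := SearchScan {
  sscan_mem : search_mem s (qs ++ ex);
  sscan_head : reg s vHead = num h.+1;
  sscan_U : reg s vU = ver u;
  sscan_I : reg s vI = num (st + i);
  sscan_i : i <= size (inc u);
  sscan_stored : stored s u st;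
  sscan_nb : forall w, w \in take i (inc u) -> L u w -> w \in qs ++ ex }.

Definition search_body : cmd :=
  if cycle_prog is
    CSeq _ (CSeq _ (CSeq _ (CSeq _ (CSeq _ (CSeq (CWhile _ c) _)))))
  then c else cycle_prog.

Definition search_inner_body : cmd :=
  if search_body is CSeq _ (CSeq _ (CSeq _ (CWhile _ c))) then c
  else cycle_prog.

Lemma search_inner_step qs h st i s ex :
  h < size qs -> i < size (inc (nth x qs h)) -> search_scan qs h st i s ex ->
  exists ex',
    search_scan qs h st i.+1 (eval_cmd inc id search_inner_body s) ex'.
Proof.
move=> hq; set u := nth x qs h => iu sc.
have M := sscan_mem sc.
have wE := entry_nth iu; set w := nth x (inc u) i in wE.
have Guw : G u w by rewrite -(incP u).2 mem_nth.
have uqe : u \in qs ++ ex by rewrite mem_cat mem_nth.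
have [uB xu] := search_sub M uqe.
have tw : take i.+1 (inc u) = rcons (take i (inc u)) w.
  by rewrite (take_nth x iu).
have LE : L u w = (w \in B) && rank_lt id (u, w) (x, y).
  by rewrite /light Guw uB.
have lstE : cell s aList (num (st + i)) = ver w.
  by rewrite (sscan_stored sc).2 // ltnW.
rewrite [search_inner_body]/= [eval_cmd _ _ _ _]/=.
rewrite (sscan_I sc) lstE (sscan_U sc) -/u [word_lt _ _ _]/=.
set s1 := set_var (set_var s vW _) vI _.
have -> : (if (id w < id u)%O then set_var (set_var s1 vLo (ver w)) vHi (ver u)
    else set_var (set_var s1 vLo (ver u)) vHi (ver w)) =
    set_var (set_var s1 vLo (ver (lo u w))) vHi (ver (hi u w)).
  by rewrite /lo /hi; case: ifP.
(* The test of the program becomes: [w] is not yet in the queue and [L u w] holds. *)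
rewrite /= (search_dist M) (search_seen M) (search_lo M) (search_hi M) negbK.
rewrite eq_ver /= -rank_ltE andbCA -LE.
have -> : ((if w \in qs ++ ex then num 1 else None) == None) =
  (w \notin qs ++ ex) by case: ifP.
case: (boolP ((w \notin qs ++ ex) && L u w)) => [/andP[wq Luw]|old] /=.
  exists (rcons ex w); rewrite (search_tail M).
  split=> //=; rewrite -?rcons_cat -/u.
  - split=> //=; try by case: M.
    + by rewrite size_rcons.
    + move=> j; rewrite size_rcons ltnS leq_eqVlt eq_num nth_rcons.
      case: eqP => [->|_ /= jq]; first by rewrite ltnn.
      by rewrite jq (search_queue M).
    + move=> v; rewrite mem_rcons inE eq_ver; case: eqP => [//|_] /=.
      exact: search_seen M v.
    + by rewrite rcons_uniq wq (search_uniq M).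
    + by rewrite mem_rcons inE (search_root M) orbT.
    + move=> v; rewrite mem_rcons inE => /orP[/eqP->|/(search_sub M)//].
      split; first by case/and4P: Luw.
      exact: connect_trans xu (connect1 Luw).
  - exact: sscan_head sc.
  - exact: sscan_U sc.
  - by rewrite addnS.
  - exact: sscan_stored sc.
  - move=> v; rewrite tw !mem_rcons !inE => /orP[->//|vi] Lv.
    by rewrite (sscan_nb sc) ?orbT.
exists ex; split=> //=.
- by split=> //=; case: M.
- exact: sscan_head sc.
- exact: sscan_U sc.
- by rewrite addnS.
- exact: sscan_stored sc.
- move=> v; rewrite tw mem_rcons inE => /orP[/eqP->|/(sscan_nb sc)//] Luw.
  by move: old; rewrite -/u Luw andbT negbK.
Qed.

Lemma runs_search_body d h s : degree_bounded G d -> 0 < d -> search_inv h s ->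
  eval_test id s (TLt (EVar vHead) (EVar vTail)) ->
  h < #|B| /\ runs inc id search_body s (300 * d) (search_inv h.+1).
Proof.
move=> Gd d0 [qs [M hH hqs closed]] /=.
rewrite hH (search_tail M) /= => hq.
have qk : size qs <= #|B|.
  rewrite -(card_uniqP (search_uniq M)); apply: subset_leq_card.
  by apply/subsetP => w /(search_sub M)[].
split; first exact: leq_trans hq qk.
set u := nth x qs h.
have ud : size (inc u) <= d.
  apply: leq_trans (Gd u); rewrite -(card_uniqP (incP u).1).
  by apply: subset_leq_card; apply/subsetP => w; rewrite inE (incP u).2.
have uq : u \in qs by apply: mem_nth.
have [st st_u] := search_stored M (search_sub M uq).1.
pose more := TNot (TEq (EGet aList (EVar vI)) ENil).
have inner s1 : search_scan qs h st 0 s1 [::] ->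
  runs inc id (CWhile more search_inner_body) s1 (d * 100 + 10)
    (search_inv h.+1).
  move=> sc; pose Inv i s2 := exists ex, search_scan qs h st i s2 ex.
  have moreE i s2 ex : search_scan qs h st i s2 ex ->
      eval_test id s2 more = (i < size (inc u)).
    move=> sc2; rewrite /= (sscan_I sc2) (sscan_stored sc2).2 ?(sscan_i sc2) //.
    by case: ltnP => iu; [rewrite entry_nth|rewrite entry_default].
  have step i s2 : Inv i s2 -> eval_test id s2 more ->
      i < size (inc u) /\
      runs inc id search_inner_body s2 (cost search_inner_body) (Inv i.+1).
    move=> [ex sc2]; rewrite (moreE _ _ _ sc2) => iu.
    split=> //; apply: runs_loop_free => //; exact: search_inner_step sc2.
  have := runs_while step (ex_intro _ [::] sc).
  apply: runs_le => [|s2 [stop [i [ex sc2]]]]; first by rewrite subn0 /=; lia.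
  have iE : i = size (inc u).
    apply/eqP; rewrite eqn_leq (sscan_i sc2) leqNgt.
    by rewrite (moreE _ _ _ sc2) in stop.
  rewrite iE in sc2.
  exists (qs ++ ex); split.
  - exact: sscan_mem sc2.
  - exact: sscan_head sc2.
  - by rewrite size_cat (leq_trans hq) // leq_addr.
  - move=> v w vh Lvw.
    have {vh} : v \in rcons (take h qs) u.
      move: vh; rewrite -take_nth // take_cat; case: ltnP => // qh.
      have -> : h.+1 - size qs = 0 by lia.
      by rewrite take0 cats0 take_oversize.
    rewrite mem_rcons inE => /orP[/eqP vu|/closed/(_ Lvw) wq]; last first.
      by rewrite mem_cat wq.
    rewrite vu in Lvw; apply: (sscan_nb sc2) => //.
    by rewrite take_size (incP u).2; case/and4P: Lvw.
have sc0 : search_scan qs h st 0 (eval_cmd inc id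
    (CSeq (CSet vU (EGet aQueue2 (EVar vHead)))
    (CSeq (CSet vHead (ESuc (EVar vHead)))
      (CSet vI (EGet aStart (EVar vU))))) s) [::].
  rewrite /= hH (search_queue M) // -/u st_u.1; split=> //=; rewrite ?cats0 -/u.
  - by split=> //=; case: M.
  - by rewrite addn0.
  - by rewrite take0.
eapply (runs_le _ (fun _ Hs => Hs)).
  do 3![apply: runs_seq; apply: runs_loop_free => //].
  exact: inner sc0.
Unshelve.
by rewrite /=; lia.
Qed.

Lemma runs_cycle d s qs : degree_bounded G d -> 0 < d ->
  qs =i B -> bfs_mem s qs -> (forall u, u \in qs -> exists st, stored s u st) ->
  runs inc id cycle_prog s (500 * (d * #|B|))
    (fun s' => reg s' vAns = num (kruskal_answer G id k x y)).
Proof.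
move=> Gd d0 qsB M st.
have B0 : 0 < #|B| by apply/card_gt0P; exists x; apply: gball_refl.
pose s0 := eval_cmd inc id (sort_prog vLoXY vHiXY vX vY) s.
have s0E : s0 = set_var (set_var s vLoXY (ver (lo x y))) vHiXY (ver (hi x y)).
  rewrite /s0 /= (mem_X M) (mem_Y M) [word_lt _ _ _]/= /lo /hi.
  by case: ifP.
have inv0 : search_inv 0 (eval_cmd inc id (CSeq (CSet vHead (ECst 0))
   (CSeq (CSet vTail (ECst 1))
   (CSeq (CPut aQueue2 (ECst 0) (EVar vX)) (CPut aSeen (EVar vX) (ECst 1)))))
   s0).
  exists [:: x]; split=> //=; rewrite s0E.
  split=> //=.
  - exact: mem_Y M.
  - by move=> w; rewrite (mem_dist M) qsB; case: ifP.
  - by move=> u; rewrite -qsB => /st[st' H]; exists st'.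
  - by case=> //= _; rewrite (mem_X M).
  - move=> w; rewrite (mem_X M) eq_ver inE; case: eqP => // _.
    exact: mem_seen M w.
  - by rewrite mem_head.
  - by move=> w; rewrite inE => /eqP->; rewrite gball_refl connect0.
eapply (runs_le _ (fun _ Hs => Hs)).
  do 5![apply: runs_seq; apply: runs_loop_free => //].
  have step h s1 := @runs_search_body d h s1 Gd d0.
  apply: runs_seq; apply: (runs_le (leqnn _)) (runs_while step inv0).
  move=> s1 /= [stop [h [ws [M1 hH hws closed]]]].
  apply: runs_loop_free => //=.
  have hw : h = size ws.
    move: stop; rewrite hH (search_tail M1) /= -leqNgt => qh.
    by apply/eqP; rewrite eqn_leq hws.
  rewrite hw take_size in closed.
  (* The exhausted queue is closed under [L] and contains [x], so it contains every vertex reachable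
     from [x]. *)
  have yws : (y \in ws) = connect L x y.
    apply/idP/idP => [/(search_sub M1)[]//|/connectP[p Lp ->]].
    elim/last_ind: p Lp => [|p z IHp]; first by move=> _; apply: search_root M1.
    rewrite rcons_path last_rcons => /andP[/IHp pw]; exact: closed.
  rewrite (search_Y M1) (search_seen M1) yws kruskal_answerE //.
  by case: (connect L x y).
Unshelve.
by rewrite /= subn0; nia.
Qed.

Lemma kruskal_prog_correct d : degree_bounded G d -> 0 < d ->
  answers_within inc id kruskal_prog k x y (kruskal_answer G id k x y)
    (1000 * (d * max_gball G k)) (1000 * (d * max_gball G k)).
Proof.
move=> Gd d0.
have le_max : #|B| <= max_gball G k by apply: leq_bigmax.
have : runs inc id kruskal_prog (init_state k x y)
    (500 * (d * #|B|) + 500 * (d * #|B|))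
    (fun s' => reg s' vAns = num (kruskal_answer G id k x y)).
  apply: runs_seq; apply: (runs_le (leqnn _)) (runs_bfs Gd d0).
  by move=> s [qs qsB [M st]]; apply: runs_cycle qsB M st.
case=> s' [q [t [run tn ans]]]; exists s', q, t.
have tn' : t <= 1000 * (d * max_gball G k) by nia.
by split=> //; apply: leq_trans (exec_queries_le_time run) tn'.
Qed.

End Bfs.

(** * Connectivity, sparsity and running time combined *)

Local Open Scope ring_scope.

Theorem theorem6 :
  exists C : nat,
  forall (R : realType) (V : finType) (G : sgraph V) (inc : V -> seq V)
    (disp : Order.disp_t) (I : orderType disp) (id : V -> I) (d : nat)
    (eps alpha beta : R) (alpha_gt0 : 0 < alpha) (beta_gt0 : 0 < beta)
    (k : nat),
    connected_rel G ->
    incidence_lists G inc ->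
    injective id ->
    (0 < d)%N ->
    degree_bounded G d ->
    0 < eps ->
    alpha + beta = eps / d%:R ->
    (kK G alpha_gt0 beta_gt0 <= k)%N ->
    [/\ forall (delta : R) (disp' : measure_display)
          (T : measurableType disp') (P : probability T R),
          0 <= delta < 1 ->
          local_sparse_spanning G eps delta P
            (fun _ : T => kruskal_answer G id k),
        forall x y : V, G x y ->
          answers_within inc id kruskal_prog k x y (kruskal_answer G id k x y)
            (C * (d * max_gball G k)) (C * (d * max_gball G k))
      & (d * max_gball G k <= C * d ^ k.+1)%N].
Proof.
(* Each of the two searches takes at most $500\, d\, n_k(G)$ steps; the constant also covers the
   factor 2 in $n_k(G) \le 2 d^k$. *)
exists 1000 => R V G inc disp I id d eps alpha beta alpha_gt0 beta_gt0 k.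
move=> Gc incG id_inj d0 Gd _ epsE kk; split.
- move=> delta disp' T P /andP[delta0 _] Q Qpres ce se.
  (* The answers are deterministic, so both events are the whole sample space. *)
  have ceT : ce = [set: T]%classic.
    by apply/seteqP; split=> // w _; apply: kruskal_connected.
  have seT : se = [set: T]%classic.
    by apply/seteqP; split=> // w _; apply: kruskal_sparse kk Qpres.
  rewrite ceT seT probability_setT; split=> //.
  by rewrite lee_fin gerBl.
- by move=> x y Gxy; apply: kruskal_prog_correct.
- by have := max_gball_le k d0 Gd; rewrite expnS; nia.
Qed.
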